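(* Let $n\in\mathbb{N}$ and assume that the positive recurrent Markov chain $\xi_1,\xi_2,\ldots$, with transition kernel $p$, invariant probability measure $\pi$ and Markov operator $P$, is weak reversible of order $n$. Then the following three conditions are equivalent: (1) $P$ has an $L^2(\pi)$-spectral gap. (2) $k_{2n}>0$. (3) $0<k_n\le K_n<2$.
   Context: Setting: $\xi_1,\xi_2,\ldots$ is a time-homogeneous, discrete-time, positive recurrent Markov chain on an arbitrary measurable state space $(\Omega,\mathcal{F})$ with transition kernel $p(x,dy)$, $n$-step kernels $p^n(x,dy)$, and uniquely determined invariant probability measure $\pi$. The Markov operator is $Pf(x)=\int_\Omega f(y)\,p(x,dy)$ on $L^2(\pi)$. Let $L^2_{0,1}(\pi)=\{f\in L^2(\pi):\int f\,d\pi=0,\ \int f^2\,d\pi=1\}$. $P$ has an $L^2(\pi)$-spectral gap if $\lim_{n\to\infty}\sup_{f\in L^2_{0,1}(\pi)}\|P^nf\|_2^{1/n}<1$. Let $Q^{(n)}$ be the measure on $\Omega^2$ with $Q^{(n)}(A\times B)=\int_A\pi(dx)\,p^n(x,B)$, and $\tilde Q^{(n)}$ the measure with $\tilde Q^{(n)}(A\times B)=Q^{(n)}(B\times A)$. It is assumed that $Q^{(n)}$ and $\tilde Q^{(n)}$ are equivalent (mutually absolutely continuous). The chain is weak reversible of order $n$ if there exists $C\in[1,\infty)$ such that $\frac1C\le\frac{dQ^{(n)}}{d\tilde Q^{(n)}}\le C$ holds $\tilde Q^{(n)}$-a.s. Isoperimetric constants: for $m\in\mathbb{N}$ and $A\in\mathcal{F}$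 with $0<\pi(A)<1$, $k_m(A):=\frac{1}{\pi(A)\pi(A^c)}\int_A p^m(x,A^c)\,\pi(dx)$, and $k_m:=\inf_A k_m(A)$, $K_m:=\sup_A k_m(A)$, over all such $A$. *)

(* Defs.v *)
From HB Require Import structures.
From mathcomp Require Import all_boot all_order all_algebra.
From mathcomp Require Import all_classical all_reals all_analysis.
From mathcomp Require Import measurable_realfun.

Set Implicit Arguments.
Unset Strict Implicit.
Unset Printing Implicit Defensive.
Import Order.TTheory GRing.Theory Num.Theory.
Import numFieldNormedType.Exports.

Local Open Scope classical_set_scope.
Local Open Scope ring_scope.
Local Open Scope ereal_scope.
Local Open Scope charge_scope.

Section kernel_powers.
Context d (T : measurableType d) (R : realType).

Let mkcomp_noparamT (k1 k2 : R.-pker T ~> T) x :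
  mkcomp_noparam k1 k2 x [set: T] = 1.
Proof.
rewrite /mkcomp_noparam/= /kcomp_noparam.
under eq_integral do rewrite prob_kernel.
by rewrite integral_cst// mul1e prob_kernel.
Qed.

HB.instance Definition _ (k1 k2 : R.-pker T ~> T) :=
  @isProbabilityKernel.Build _ _ T T R (mkcomp_noparam k1 k2)
    (mkcomp_noparamT k1 k2).

Fixpoint kiter (p : R.-pker T ~> T) (n : nat) : R.-pker T ~> T :=
  match n with
  | 0 => kdirac (@measurable_id _ T [set: T])
  | m.+1 => mkcomp_noparam p (kiter p m)
  end.

End kernel_powers.

Section edge_measure.
Context d (T : measurableType d) (R : realType).
Variables (pi : probability T R) (k : R.-pker T ~> T).

(* The measure pi(dx) k(x, dy) on T * T; its values on rectangles are
   computed in edge_measureX. *)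
Definition edge_measure (E : set (T * T)) : \bar R :=
  \int[pi]_x k x (xsection E x).

Let measurable_section (E : set (T * T)) : measurable E ->
  measurable_fun [set: T] (fun x => k x (xsection E x)).
Proof.
by move=> mE; apply: measurable_fun_xsection_finite_kernel => //; rewrite inE.
Qed.

Let edge_measure0 : edge_measure set0 = 0.
Proof. by apply: integral0_eq => x _; rewrite xsection0 measure0. Qed.

Let edge_measure_ge0 E : 0 <= edge_measure E.
Proof. exact: integral_ge0. Qed.

Let edge_measure_sigma_additive : semi_sigma_additive edge_measure.
Proof.
move=> F mF tF mUF.
have -> : edge_measure (\bigcup_n F n) =
    \sum_(0 <= i <oo) edge_measure (F i).
  rewrite /edge_measure -integral_nneseries//; last first.
    by move=> i; exact: measurable_section.
  apply: eq_integral => x _; rewrite xsection_bigcup measure_bigcup//.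
  - by apply: eq_eseriesl => i; rewrite in_setT.
  - by move=> i _; exact: measurable_xsection.
  - exact: trivIset_xsection.
exact: is_cvg_ereal_nneg_natsum.
Qed.

HB.instance Definition _ := isMeasure.Build _ _ _ edge_measure
  edge_measure0 edge_measure_ge0 edge_measure_sigma_additive.

Let edge_measure_fin : fin_num_fun edge_measure.
Proof.
apply: lty_fin_num_fun; apply: (@le_lt_trans _ _ 1); last by rewrite ltey.
apply: (@le_trans _ _ (\int[pi]_x 1)); last first.
  by rewrite integral_cst// mul1e sprobability_setT.
apply: ge0_le_integral => //; first exact: measurable_section.
move=> x _; apply: le_trans (sprob_kernel_le1 k x).
by apply: le_measure; rewrite ?inE//; exact: measurable_xsection.
Qed.

HB.instance Definition _ := @Measure_isFinite.Build _ _ _ edge_measure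
  edge_measure_fin.

Lemma edge_measureX (A B : set T) : measurable A -> measurable B ->
  edge_measure (A `*` B) = \int[pi]_(x in A) k x B.
Proof.
move=> mA mB; rewrite /edge_measure [RHS]integral_mkcond.
apply: eq_integral => x _; rewrite patchE; case: ifPn => xA.
  by rewrite in_xsectionX.
by rewrite notin_xsectionX// measure0.
Qed.

Definition edge_measure_rev : set (T * T) -> \bar R :=
  pushforward edge_measure (fun z : T * T => (z.2, z.1)).

Let mswap : measurable_fun [set: T * T] (fun z : T * T => (z.2, z.1)).
Proof. exact: measurable_swap. Qed.

Let edge_measure_rev0 : edge_measure_rev set0 = 0.
Proof. by rewrite /edge_measure_rev /pushforward preimage_set0 measure0. Qed.

Let edge_measure_rev_ge0 E : 0 <= edge_measure_rev E.
Proof. exact: measure_ge0. Qed.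

Let edge_measure_rev_sigma_additive : semi_sigma_additive edge_measure_rev.
Proof.
move=> F mF tF mUF; rewrite /edge_measure_rev /pushforward preimage_bigcup.
apply: measure_semi_sigma_additive.
- by move=> n; rewrite -[X in measurable X]setTI; exact: mswap.
- apply/trivIsetP => /= i j _ _ ij; rewrite -preimage_setI.
  by move/trivIsetP : tF => /(_ _ _ _ _ ij) ->//; rewrite preimage_set0.
- by rewrite -preimage_bigcup -[X in measurable X]setTI; exact: mswap.
Qed.

HB.instance Definition _ := isMeasure.Build _ _ _ edge_measure_rev
  edge_measure_rev0 edge_measure_rev_ge0 edge_measure_rev_sigma_additive.

Let edge_measure_rev_fin : fin_num_fun edge_measure_rev.
Proof.
move=> E mE; apply: edge_measure_fin.
by rewrite -[X in measurable X]setTI; exact: mswap.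
Qed.

HB.instance Definition _ := @Measure_isFinite.Build _ _ _ edge_measure_rev
  edge_measure_rev_fin.

Lemma edge_measure_revX (A B : set T) : measurable A -> measurable B ->
  edge_measure_rev (A `*` B) = edge_measure (B `*` A).
Proof.
move=> mA mB; rewrite /edge_measure_rev /pushforward; congr edge_measure.
by apply/seteqP; split => -[x y] [].
Qed.

End edge_measure.

Section markov_chain.
Context d (T : measurableType d) (R : realType).
Implicit Types (p : R.-pker T ~> T) (pi : probability T R).

Definition invariant_measure p (mu : {measure set T -> \bar R}) :=
  forall A, measurable A -> \int[mu]_x p x A = mu A.

Definition unique_invariant_probability p pi :=
  invariant_measure p pi /\
  forall nu : probability T R, invariant_measure p nu ->
    forall A, measurable A -> nu A = pi A.

Definition irreducibility_measure p
    (phi : {sigma_finite_measure set T -> \bar R}) :=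
  0 < phi [set: T] /\
  forall A, measurable A -> 0 < phi A ->
    forall x, exists2 m, (0 < m)%N & 0 < kiter p m x A.

Definition maximal_irreducibility_measure p
    (psi : {sigma_finite_measure set T -> \bar R}) :=
  irreducibility_measure p psi /\
  forall phi, irreducibility_measure p phi -> phi `<< psi.

(* Recurrence in the sense of general state space chains: the expected number
   of visits to A is infinite, from every starting point, for every A charged
   by a maximal irreducibility measure. *)
Definition recurrent p :=
  exists2 psi, maximal_irreducibility_measure p psi &
    forall A, measurable A -> 0 < psi A ->
      forall x, \sum_(1 <= m <oo) kiter p m x A = +oo.

Definition positive_recurrent p :=
  recurrent p /\ exists mu : probability T R, invariant_measure p mu.

(* On elements of L^2(pi) the integral converges for pi-almost every x when pi
   is invariant; elsewhere Rintegral takes a default value. *)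
Definition markov_op p (f : T -> R) : T -> R := fun x => (\int[p x]_y f y)%R.

Definition L2_01 pi : set (T -> R) :=
  [set f | [/\ f \in Lfun pi 2%:E, (\int[pi]_x f x = 0)%R
             & (\int[pi]_x f x ^+ 2 = 1)%R]].

Definition L2_spectral_gap p pi :=
  let u := fun m : nat =>
    ereal_sup [set ('N[pi]_2%:E[EFin \o iter m (markov_op p) f])
                     `^ (m%:R^-1)%R | f in L2_01 pi] in
  cvgn u /\ limn u < 1.

Definition equivalent_edge_measures p pi n :=
  edge_measure pi (kiter p n) `<< edge_measure_rev pi (kiter p n) /\
  edge_measure_rev pi (kiter p n) `<< edge_measure pi (kiter p n).

Definition weak_reversible p pi n :=
  let Q := edge_measure pi (kiter p n) in
  let Q' := edge_measure_rev pi (kiter p n) in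
  exists2 C : R, (1 <= C)%R &
    {ae Q', forall z, (C^-1)%:E <= ('d (charge_of_finite_measure Q) '/d Q') z
                      <= C%:E}.

Definition nontrivial_set pi : set (set T) :=
  [set A | measurable A /\ 0 < pi A < 1].

Definition isoperimetric_ratio p pi m (A : set T) : \bar R :=
  (\int[pi]_(x in A) kiter p m x (~` A)) / (pi A * pi (~` A)).

Definition iso_inf p pi m : \bar R :=
  ereal_inf [set isoperimetric_ratio p pi m A | A in nontrivial_set pi].

Definition iso_sup p pi m : \bar R :=
  ereal_sup [set isoperimetric_ratio p pi m A | A in nontrivial_set pi].

End markov_chain.

(* Main.v *)
From HB Require Import structures.
Require Import Defs.
From mathcomp Require Import all_boot all_order all_algebra.
From mathcomp Require Import all_classical all_reals all_analysis.
From mathcomp Require Import measurable_realfun.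
From mathcomp Require Import ring lra.

(** Everything is read off the edge measures [pi(dx) p^m(x, dy)].  Testing with
    the normalized indicator [f] of [A] gives [k_m(A) = 1 - <f, P^m f>], and
    [|P^m f -+ f|^2 <= 2 -+ 2 <f, P^m f>].  So [k_m(A)] close to [0] makes [f]
    almost [P^m]-invariant, and [k_n(A)] close to [2] makes it almost
    [P^n]-antiinvariant, hence almost [P^(2n)]-invariant: this gives (1) => (2)
    and (2) => (3) without weak reversibility.

    (2) => (1).  Integrating the nonnegative function
    [f(x)^2 - 2 f(x) P^n f(y) + P^n(f^2)(y)] against [Q] and its reversal,
    [Q <= C Q~] becomes [|f|^2 - <f, P^(2n) f> <= C (|f|^2 - |P^n f|^2)], and
    Cheeger's inequality for [p^(2n)] bounds the left side below by a multiple of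
    the variance of [f].  Thus [P^n] contracts mean-zero functions, and
    submultiplicativity gives the spectral gap.

    (3) => (2).  If [k_2n(A)] is small then [Q <= C Q~] forces
    [\int p^n(x, A) p^n(x, A^c) pi(dx)] to be small, so [P^n 1_A] is close to
    [1_B] with [B = {P^n 1_A > 1/2}], and [P^n 1_B] is close to [1_A].  Then
    [A `|` B] and [A `&` B] are almost invariant, so by [k_n > 0] they are almost
    full and almost null: [P^n] nearly exchanges [A] with its complement, and
    [k_n(A)] is close to [2]. *)

Import Order.TTheory GRing.Theory Num.Theory.
Import numFieldNormedType.Exports.
Import HBNNSimple.

Set Implicit Arguments.
Unset Strict Implicit.

Local Open Scope classical_set_scope.
Local Open Scope ring_scope.
Local Open Scope ereal_scope.

(** * Integration against mixtures of measures *)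

Section mixture.
Context {d1 d2 : measure_display} {X : measurableType d1}
  {Z : measurableType d2} {R : realType}.
Variables (nu : {measure set X -> \bar R}) (mu : {measure set Z -> \bar R})
  (k : X -> {measure set Z -> \bar R}).
Hypothesis mk : forall E, measurable E -> measurable_fun [set: X] (k ^~ E).
Hypothesis muE : forall E, measurable E -> mu E = \int[nu]_x k x E.

(** For indicators this is [muE]; simple functions follow by linearity and the rest by monotone
    convergence, inside and outside. Taking [k] as a bare family of measures covers invariance,
    Chapman-Kolmogorov and edge measures alike. *)
Lemma ge0_integral_mixture (f : Z -> \bar R) :
  measurable_fun [set: Z] f -> (forall z, 0 <= f z) ->
  \int[mu]_z f z = \int[nu]_x \int[k x]_z f z.
Proof.
move=> mf f0.
pose g := nnsfun_approx measurableT mf.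
pose gE := fun n => EFin \o g n.
have mgE n : measurable_fun [set: Z] (gE n) by exact/measurable_EFinP.
have gE_ge0 n x : 0 <= gE n x by rewrite lee_fin.
have nd_gE x : {homo gE ^~ x : n m / (n <= m)%O >-> n <= m}.
  by move=> *; exact/lefP/nd_nnsfun_approx.
transitivity (limn (fun n => \int[mu]_x gE n x)).
  rewrite -monotone_convergence//; apply: eq_integral => t _.
  by apply/esym/cvg_lim => //; exact: cvg_nnsfun_approx.
transitivity (limn (fun n => \int[nu]_x \int[k x]_z gE n z)).
  apply: congr_lim; apply/funext => n.
  rewrite integralT_nnsfun sintegralE.
  under [RHS]eq_integral do rewrite integralT_nnsfun sintegralE.
  rewrite ge0_integral_fsum//; last 2 first.
    by move=> r; apply: measurable_funeM; exact: mk.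
    by move=> r x _; exact: nnsfun_mulemu_ge0.
  apply: eq_fsbigr => // r rh; rewrite muE//.
  have [r0|r0] := leP 0%R r.
    by rewrite ge0_integralZl//; exact: mk.
  rewrite !(preimage_nnfun0 _ r0).
  by rewrite [RHS]integral0_eq ?integral0_eq ?mule0// => x _;
    rewrite ?measure0 ?mule0.
rewrite -[LHS]monotone_convergence//; last 3 first.
- by move=> n; apply: measurable_fun_integral_kernel.
- by move=> n x _; exact: integral_ge0.
- by move=> x _ m n mn; apply: ge0_le_integral => // t _; exact: nd_gE.
apply: eq_integral => x _.
rewrite -monotone_convergence//.
apply: eq_integral => t _.
by apply/cvg_lim => //; exact: cvg_nnsfun_approx.
Qed.

End mixture.

(** * Bounded measurable functions *)

(** The bound holds everywhere, not almost everywhere, so such [f] are integrable under [pi] and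
    under every [p x], and [P f] is again of this kind. *)
Definition bmeas {d : measure_display} {T : measurableType d} {R : realType}
    (f : T -> R) :=
  measurable_fun [set: T] f /\ exists M : R, forall x, (`|f x| <= M)%R.

Section bmeas_closure.
Local Open Scope ring_scope.
Context {d : measure_display} {T : measurableType d} {R : realType}.
Implicit Types f g : T -> R.

Lemma bmeas_cst (c : R) : bmeas (fun _ : T => c).
Proof. by split; [exact: measurable_cst|exists `|c|]. Qed.

Lemma bmeas_indic (A : set T) : measurable A -> bmeas (\1_A : T -> R).
Proof.
move=> mA; split; first exact: measurable_indic.
by exists 1 => x; rewrite indicE; case: (_ \in _); rewrite ?normr1// normr0.
Qed.

Lemma bmeasD f g : bmeas f -> bmeas g -> bmeas (fun x => f x + g x).
Proof.
move=> [mf [M fM]] [mg [N gN]]; split; first exact: measurable_funD.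
by exists (M + N) => x; rewrite (le_trans (ler_normD _ _))// lerD.
Qed.

Lemma bmeasN f : bmeas f -> bmeas (fun x => - f x).
Proof.
move=> [mf [M fM]]; split; first exact: measurable_funN.
by exists M => x; rewrite normrN.
Qed.

Lemma bmeasM f g : bmeas f -> bmeas g -> bmeas (fun x => f x * g x).
Proof.
move=> [mf [M fM]] [mg [N gN]]; split; first exact: measurable_funM.
by exists (M * N) => x; rewrite normrM ler_pM.
Qed.

Lemma bmeasX f n : bmeas f -> bmeas (fun x => f x ^+ n).
Proof.
move=> [mf [M fM]]; split; first exact: measurable_funX.
by exists (M ^+ n) => x; rewrite normrX lerXn2r// nnegrE// (le_trans _ (fM x)).
Qed.

Lemma bmeas_norm f : bmeas f -> bmeas (fun x => `|f x|).
Proof.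
move=> [mf [M fM]]; split; first exact: measurableT_comp.
by exists M => x; rewrite normr_id.
Qed.

Lemma bmeas_max f g : bmeas f -> bmeas g -> bmeas (fun x
  => Num.max (f x) (g x)).
Proof.
move=> [mf [M fM]] [mg [N gN]]; split; first exact: measurable_maxr.
exists (Num.max M N) => x; rewrite le_max; have := fM x; have := gN x.
by case: (leP (f x) (g x)) => _ gN' fM'; rewrite ?gN' ?fM' ?orbT.
Qed.

Lemma bmeas_min f g : bmeas f -> bmeas g -> bmeas (fun x
  => Num.min (f x) (g x)).
Proof.
move=> [mf [M fM]] [mg [N gN]]; split; first exact: measurable_minr.
exists (Num.max M N) => x; rewrite le_max; have := fM x; have := gN x.
by case: (leP (f x) (g x)) => _ gN' fM'; rewrite ?gN' ?fM' ?orbT.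
Qed.

Lemma bmeas_comp d' (U : measurableType d') (phi : U -> T) f :
  measurable_fun [set: U] phi -> bmeas f -> bmeas (fun u => f (phi u)).
Proof.
by move=> mphi [mf [M fM]]; split; [exact: measurableT_comp|exists M].
Qed.

End bmeas_closure.

Ltac bmeas := repeat first
  [ assumption | exact: bmeas_cst | exact: measurable_fst
  | exact: measurable_snd
  | match goal with
    | |- bmeas (fun x => (_ + _)%R) => apply: bmeasD
    | |- bmeas (fun x => (- _)%R) => apply: bmeasN
    | |- bmeas (fun x => (_ * _)%R) => apply: bmeasM
    | |- bmeas (fun x => (_ ^+ _)%R) => apply: bmeasX
    | |- bmeas (fun x => `| _ |%R) => apply: bmeas_norm
    | |- bmeas (fun x => Num.max _ _) => apply: bmeas_max
    | |- bmeas (fun x => Num.min _ _) => apply: bmeas_min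
    | |- bmeas (fun x => _ (fst x)) => apply: (@bmeas_comp _ _ _ _ _ fst)
    | |- bmeas (fun x => _ (snd x)) => apply: (@bmeas_comp _ _ _ _ _ snd)
    | |- bmeas _ => apply: bmeas_indic
    end ].

Section bmeas_integral.
Local Open Scope ring_scope.
Context {d : measure_display} {T : measurableType d} {R : realType}.
Variable mu : {measure set T -> \bar R}.
Hypothesis mu1 : mu [set: T] = 1%E.
Implicit Types f g : T -> R.

Lemma bmeas_integrable f : bmeas f -> mu.-integrable [set: T] (EFin \o f).
Proof.
move=> [mf [M fM]]; apply: measurable_bounded_integrable => //.
  by rewrite mu1 ltry.
by exists M; split; [exact: num_real|move=> N MN x _;
  exact: le_trans (fM x) (ltW MN)].
Qed.

Lemma bRintE f : bmeas f ->
  (\int[mu]_x (f x)%:E = (\int[mu]_x f x)%R%:E)%E.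
Proof.
move=> bf; rewrite /Rintegral fineK//.
exact: integrable_fin_num (bmeas_integrable bf).
Qed.

Lemma bRintD f g : bmeas f -> bmeas g ->
  \int[mu]_x (f x + g x) = \int[mu]_x f x + \int[mu]_x g x.
Proof. by move=> bf bg; rewrite RintegralD//; exact: bmeas_integrable. Qed.

Lemma bRintB f g : bmeas f -> bmeas g ->
  \int[mu]_x (f x - g x) = \int[mu]_x f x - \int[mu]_x g x.
Proof. by move=> bf bg; rewrite RintegralB//; exact: bmeas_integrable. Qed.

Lemma bRintZ (c : R) f : bmeas f ->
  \int[mu]_x (c * f x) = c * \int[mu]_x f x.
Proof. by move=> bf; rewrite RintegralZl//; exact: bmeas_integrable. Qed.

Lemma bRint_cst (c : R) : \int[mu]_x c = c.
Proof. by rewrite Rintegral_cst// [X in fine X]mu1 mulr1. Qed.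

Lemma bRint_indic (A : set T) : measurable A ->
  \int[mu]_x (\1_A x : R) = fine (mu A).
Proof. by move=> mA; rewrite /Rintegral integral_indic// setIT. Qed.

Lemma le_bRint f g : bmeas f -> bmeas g -> (forall x, f x <= g x) ->
  \int[mu]_x f x <= \int[mu]_x g x.
Proof. by move=> bf bg fg; apply: le_Rintegral => //;
  exact: bmeas_integrable. Qed.

Lemma bRint_sqr_ge f : bmeas f ->
  (\int[mu]_x f x) ^+ 2 <= \int[mu]_x (f x ^+ 2).
Proof.
move=> bf; set m := \int[mu]_x f x.
rewrite -subr_ge0.
have -> : \int[mu]_x (f x ^+ 2) - m ^+ 2 = \int[mu]_x ((f x - m) ^+ 2).
  transitivity (\int[mu]_x (f x ^+ 2 + (- (2 * m) * f x + m ^+ 2))).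
    rewrite bRintD; [|bmeas..]. rewrite bRintD; [|bmeas..].
    by rewrite bRintZ// bRint_cst -/m; ring.
  by apply: eq_Rintegral => x _; ring.
by apply: Rintegral_ge0 => x _; exact: sqr_ge0.
Qed.

End bmeas_integral.

Section bounded_mixture.
Local Open Scope ring_scope.
Context {d1 d2 : measure_display} {X : measurableType d1}
  {Z : measurableType d2} {R : realType}.
Variables (k : X -> {measure set Z -> \bar R}).
Hypothesis mk : forall E, measurable E -> measurable_fun [set: X] (k ^~ E).
Hypothesis k1 : forall x, k x [set: Z] = 1%E.

Lemma bmeas_kernel (f : Z -> R) : bmeas f -> bmeas (fun x => \int[k x]_z f z).
Proof.
move=> bf; have [mf [M fM]] := bf; split; last first.
  exists M => x; rewrite (le_trans (le_normr_Rintegral _ _))//.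
    exact: bmeas_integrable.
  rewrite -[leRHS](bRint_cst (k1 x)); apply: le_bRint => //; bmeas.
have bM x : (M%:E = \int[k x]_z M%:E)%E.
  by rewrite integral_cst// [X in (_ * X)%E]k1 mule1.
(* Adding the bound [M] makes the integrand nonnegative, where measurability of kernel integrals is
   known; mass one lets [M] be subtracted again. *)
have -> : (fun x => \int[k x]_z f z) =
    (fun x => fine (\int[k x]_z (f z + M)%:E)%E - M).
  apply/funext => x; rewrite -/(Rintegral _ _ _) bRintD//; last by bmeas.
  by rewrite bRint_cst// addrK.
apply: measurable_funB => //; apply: measurableT_comp => //.
apply: measurable_fun_integral_kernel => //.
  by move=> z; rewrite lee_fin -lerBlDr sub0r lerNl (le_trans _ (fM z))//
    -normrN ler_norm.
by apply/measurable_EFinP; apply: measurable_funD.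
Qed.

Variables (nu : {measure set X -> \bar R}) (mu : {measure set Z -> \bar R}).
Hypothesis nu1 : nu [set: X] = 1%E.
Hypothesis muE : forall E, measurable E -> (mu E = \int[nu]_x k x E)%E.

Let mu1 : mu [set: Z] = 1%E.
Proof.
rewrite muE//; under eq_integral do rewrite k1.
by rewrite integral_cst// mul1e; exact: nu1.
Qed.

Lemma bRint_mixture (f : Z -> R) : bmeas f ->
  \int[mu]_z f z = \int[nu]_x \int[k x]_z f z.
Proof.
move=> bf; have [mf [M fM]] := bf.
have bfM : bmeas (fun z => f z + M) by bmeas.
(* The same shift by [M] reduces to the nonnegative case; [M] then cancels. *)
have h : \int[mu]_z (f z + M) = \int[nu]_x \int[k x]_z (f z + M).
  apply: EFin_inj; rewrite -!bRintE//; last exact: bmeas_kernel.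
  rewrite (ge0_integral_mixture mk muE).
  - by apply: eq_integral => x _; rewrite bRintE.
  - by apply/measurable_EFinP; case: bfM.
  - by move=> z; rewrite lee_fin -lerBlDr sub0r lerNl (le_trans _ (fM z))//
      -normrN ler_norm.
move: h; rewrite bRintD//; last by bmeas.
rewrite bRint_cst//; under [in RHS]eq_Rintegral => x _.
  rewrite bRintD//; last by bmeas.
  rewrite bRint_cst//; over.
rewrite bRintD//; [|exact: bmeas_kernel|by bmeas].
by rewrite bRint_cst// => /addIr.
Qed.

End bounded_mixture.

(** * Markov operators on bounded functions *)

Section markov_bounded.
Local Open Scope ring_scope.
Context {d : measure_display} {T : measurableType d} {R : realType}.
Implicit Types (k p : R.-pker T ~> T) (pi : probability T R) (f g : T -> R).

Let mker k : forall E, measurable E -> measurable_fun [set: T] (k ^~ E).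
Proof. by move=> E mE; exact: measurable_kernel. Qed.

Lemma bmeas_markov k f : bmeas f -> bmeas (markov_op k f).
Proof. by apply: bmeas_kernel; [exact: mker|move=> x; exact: prob_kernel]. Qed.

Lemma bmeas_iter_markov p f n : bmeas f -> bmeas (iter n (markov_op p) f).
Proof. by move=> bf; elim: n => //= n; exact: bmeas_markov. Qed.

Lemma markovD k f g : bmeas f -> bmeas g -> forall x,
  markov_op k (fun x => f x + g x) x = markov_op k f x + markov_op k g x.
Proof. by move=> bf bg x; apply: bRintD => //; exact: prob_kernel. Qed.

Lemma markovB k f g : bmeas f -> bmeas g -> forall x,
  markov_op k (fun x => f x - g x) x = markov_op k f x - markov_op k g x.
Proof. by move=> bf bg x; apply: bRintB => //; exact: prob_kernel. Qed.

Lemma markovZ k c f : bmeas f -> forall x,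
  markov_op k (fun x => c * f x) x = c * markov_op k f x.
Proof. by move=> bf x; apply: bRintZ => //; exact: prob_kernel. Qed.

Lemma markov_cst k c x : markov_op k (fun _ => c) x = c.
Proof. by apply: bRint_cst; exact: prob_kernel. Qed.

Lemma le_markov k f g : bmeas f -> bmeas g -> (forall x, f x <= g x) ->
  forall x, markov_op k f x <= markov_op k g x.
Proof. by move=> bf bg fg x; apply: le_bRint => //; exact: prob_kernel. Qed.

Lemma markov_sqr_ge k f : bmeas f -> forall x,
  (markov_op k f x) ^+ 2 <= markov_op k (fun x => f x ^+ 2) x.
Proof. by move=> bf x; apply: bRint_sqr_ge => //; exact: prob_kernel. Qed.

Lemma ge0_integral_invariant k (pi : {measure set T -> \bar R}) :
  invariant_measure k pi -> forall f : T -> \bar R,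
  measurable_fun [set: T] f -> (forall x, 0 <= f x)%E ->
  (\int[pi]_x \int[k x]_y f y = \int[pi]_x f x)%E.
Proof.
move=> kpi f mf f0; rewrite [RHS](ge0_integral_mixture (mker k) (nu := pi))//
  => E mE.
by rewrite kpi.
Qed.

Lemma bRint_markov k pi f : invariant_measure k pi -> bmeas f ->
  \int[pi]_x markov_op k f x = \int[pi]_x f x.
Proof.
move=> kpi bf; rewrite [RHS](bRint_mixture (mker k) _ (nu := pi))//.
- by move=> x; exact: prob_kernel.
- exact: probability_setT.
- by move=> E mE; rewrite kpi.
Qed.

(** Chapman-Kolmogorov: this links the kernels [p^m] behind the isoperimetric constants to the
    iterates of [P] behind the spectral gap. *)
Lemma markov_kiter p n f : bmeas f ->
  markov_op (kiter p n) f = iter n (markov_op p) f.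
Proof.
move=> bf; elim: n => [|n ih] /=; apply/funext => x.
  rewrite /markov_op /Rintegral /= integral_dirac//.
    by rewrite diracT mul1e.
  by apply/measurable_EFinP; case: bf.
rewrite -ih; apply: (bRint_mixture (mker (kiter p n))) => //.
- by move=> y; exact: prob_kernel.
- exact: prob_kernel.
Qed.

Lemma invariant_kiter p (pi : {measure set T -> \bar R}) n :
  invariant_measure p pi -> invariant_measure (kiter p n) pi.
Proof.
move=> ppi; elim: n => [|n ih] A mA.
  under eq_integral do rewrite /= diracE -indicE.
  by rewrite integral_indic// setIT.
rewrite -(ih A mA).
by apply: (ge0_integral_invariant ppi (mker (kiter p n) mA)).
Qed.

Section edge.
Variables (pi : probability T R) (k : R.-pker T ~> T).

Let mpair (x : T) : measurable_fun [set: T] (pair x : T -> T * T).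
Proof. exact: measurable_pair1. Qed.

Lemma edge_measureT : edge_measure pi k [set: T * T] = 1%E.
Proof.
rewrite -setXTT edge_measureX//; under eq_integral do rewrite prob_kernel.
by rewrite integral_cst// mul1e; exact: probability_setT.
Qed.

(** The law of the edge [(x, y)] with [y] drawn from [k x]; the edge measure is the mixture of these
    laws over [pi]. *)
Let kp x : {measure set (T * T) -> \bar R} :=
  measure_function_pushforward__canonical__measure_function_Measure
    (k x) (mpair x).

Let kpE x E : kp x E = k x (xsection E x).
Proof. by rewrite /kp/= /pushforward xsectionE. Qed.

Let measurable_kp E : measurable E -> measurable_fun [set: T] (kp ^~ E).
Proof.
move=> mE; under eq_fun do rewrite kpE.
by apply: measurable_fun_xsection_finite_kernel; rewrite inE.
Qed.

Let kp1 x : kp x [set: T * T] = 1%E.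
Proof. by rewrite /kp/= /pushforward preimage_setT prob_kernel. Qed.

Let Rint_kp (F : T * T -> R) x : bmeas F ->
  \int[kp x]_z F z = \int[k x]_y F (x, y).
Proof.
move=> bF; rewrite /Rintegral integral_pushforward//.
  by apply/measurable_EFinP; case: bF.
rewrite preimage_setT.
apply: (bmeas_integrable (@prob_kernel _ _ _ _ _ k x)).
split; first by apply: measurableT_comp => //; case: bF.
by case: bF => _ [M FM]; exists M.
Qed.

Lemma bmeas_edge (F : T * T -> R) : bmeas F ->
  bmeas (fun x => \int[k x]_y F (x, y)).
Proof.
move=> bF; under eq_fun do rewrite -Rint_kp//.
exact: bmeas_kernel.
Qed.

Lemma bRint_edge (F : T * T -> R) : bmeas F ->
  \int[edge_measure pi k]_z F z = \int[pi]_x \int[k x]_y F (x, y).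
Proof.
move=> bF; rewrite (@bRint_mixture _ _ _ _ _ kp _ _ pi)//.
- by apply: eq_Rintegral => x _; rewrite Rint_kp.
- exact: probability_setT.
- by move=> E mE; apply: eq_integral => x _; rewrite kpE.
Qed.

End edge.
End markov_bounded.

(** * Weak reversibility *)

Section density_bound.
Context {d : measure_display} {T : measurableType d} {R : realType}.
Variables (nu : {finite_measure set T -> \bar R})
  (mu : {finite_measure set T -> \bar R}) (C : R).
Hypothesis C0 : (0 <= C)%R.
Hypothesis numu : nu `<< mu.
Hypothesis hC : {ae mu, forall x,
  Radon_Nikodym (charge_of_finite_measure nu) mu x <= C%:E}.

Lemma ge0_integral_density_le (F : T -> \bar R) :
  (forall x, 0 <= F x) -> nu.-integrable [set: T] F ->
  \int[nu]_x F x <= \int[mu]_x (F x * C%:E).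
Proof.
move=> F0 iF; rewrite -(Radon_Nikodym_change_of_variables numu)//.
set h := Radon_Nikodym _ _.
have mF : measurable_fun [set: T] F := measurable_int nu iF.
have mh : measurable_fun [set: T] h.
  by apply: measurable_int; exact: Radon_Nikodym_integrable.
have mFh : measurable_fun [set: T] (fun x => F x * h x).
  exact: emeasurable_funM.
(* The derivative of a charge carries no pointwise sign, so the negative part is dropped and the
   positive part is compared with [C]. *)
rewrite integralE.
apply: (@le_trans _ _ (\int[mu]_x (fun x => F x * h x)^\+ x)).
  by rewrite geeDl// oppe_le0; exact: integral_ge0.
apply: ae_ge0_le_integral => //.
- exact: measurable_funepos.
- by move=> x _; rewrite mule_ge0.
- by apply: emeasurable_funM.
apply: filterS hC => x hx _.
rewrite funeposE ge_max mule_ge0// andbT.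
exact: lee_wpmul2l.
Qed.

End density_bound.

(** [Q <= C Q~] tested on bounded nonnegative functions: the density-free form in which weak
    reversibility enters every later estimate. *)
Definition edge_dominated {d : measure_display} {T : measurableType d}
    {R : realType} (pi : probability T R) (k : R.-pker T ~> T) (C : R) :=
  forall F : T * T -> R, bmeas F -> (forall z, (0 <= F z)%R) ->
  (\int[pi]_x \int[k x]_y F (x, y) <= C * \int[pi]_x \int[k x]_y F (y, x))%R.

Section edge_dominated.
Local Open Scope ring_scope.
Context {d : measure_display} {T : measurableType d} {R : realType}.
Implicit Types (k p : R.-pker T ~> T) (pi : probability T R) (f g : T -> R).

Lemma edge_measure_revT pi k : edge_measure_rev pi k [set: T * T] = 1%E.
Proof.
by rewrite -setXTT edge_measure_revX// setXTT edge_measureT.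
Qed.

Lemma bRint_edge_rev pi k (F : T * T -> R) : bmeas F ->
  \int[edge_measure_rev pi k]_z F z = \int[pi]_x \int[k x]_y F (y, x).
Proof.
move=> bF; have bF' : bmeas (fun z => F (z.2, z.1)).
  by apply: (bmeas_comp (phi := fun z : T * T => (z.2, z.1))) => //;
    exact: measurable_swap.
rewrite -[RHS](bRint_edge pi k bF')/= /Rintegral; congr fine.
have mF : measurable_fun [set: T * T] (EFin \o F).
  by apply/measurable_EFinP; case: bF.
have := @integral_pushforward _ _ _ _ R _ (@measurable_swap _ _ T T)
  (edge_measure pi k) _ _ mF _ measurableT; rewrite preimage_setT; apply.
exact: (bmeas_integrable (edge_measureT pi k) bF').
Qed.

(** Absolute continuity makes the Radon-Nikodym derivative a true density of [Q], so its almost sure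
    bound by [C] passes to integrals. *)
Lemma weak_reversible_edge_dominated p pi n :
  equivalent_edge_measures p pi n -> weak_reversible p pi n ->
  exists2 C : R, 0 < C & edge_dominated pi (kiter p n) C.
Proof.
move=> [QQ' _] [C C1 hC]; exists C; first exact: lt_le_trans C1.
move=> F bF F0; rewrite -bRint_edge// -bRint_edge_rev//.
have bFC : bmeas (fun z => C * F z) by bmeas.
rewrite -lee_fin EFinM -!bRintE//;
  [|exact: edge_measure_revT|exact: edge_measureT].
have iF := bmeas_integrable (edge_measureT pi (kiter p n)) bF.
apply: le_trans (ge0_integral_density_le (le_trans ler01 C1) QQ' _ _ iF) _.
- by apply: filterS hC => x /andP[].
- by move=> x /=; rewrite lee_fin.
rewrite integralZr//; first by rewrite muleC.
exact: (bmeas_integrable (edge_measure_revT pi (kiter p n)) bF).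
Qed.

Lemma edge_dominated_energy pi k C f : invariant_measure k pi ->
  edge_dominated pi k C -> bmeas f ->
  \int[pi]_x (f x ^+ 2) - \int[pi]_x (f x * markov_op k (markov_op k f) x)
  <= C * (\int[pi]_x (f x ^+ 2) - \int[pi]_x (markov_op k f x ^+ 2)).
Proof.
move=> kpi domk bf.
have pi1 : pi [set: T] = 1%E by exact: probability_setT.
have k1 x : k x [set: T] = 1%E by exact: prob_kernel.
set g := markov_op k f; have bg : bmeas g by exact: bmeas_markov.
pose f2 x := f x ^+ 2; have bf2 : bmeas f2 by rewrite /f2; bmeas.
pose h := markov_op k f2; have bh : bmeas h by exact: bmeas_markov.
have bPg : bmeas (markov_op k g) by exact: bmeas_markov.
have bPh : bmeas (markov_op k h) by exact: bmeas_markov.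
pose F (z : T * T) := f2 z.1 + (- 2 * (f z.1 * g z.2) + h z.2).
have bF : bmeas F by rewrite /F; bmeas.
(* By Jensen [h - g^2], the conditional variance of [f] after one step, is nonnegative, so [F] is a
   square plus a variance. *)
have F0 z : 0 <= F z.
  have -> : F z = (f z.1 - g z.2) ^+ 2 + (h z.2 - g z.2 ^+ 2).
    by rewrite /F /f2; ring.
  by rewrite addr_ge0 ?sqr_ge0// subr_ge0; exact: markov_sqr_ge.
have := domk F bF F0.
(* Along [Q] the kernel averages [g(y)], which makes a second step; invariance gives [markov_op k h]
   the integral of [f2]. *)
have -> : \int[pi]_x \int[k x]_y F (x, y) =
    2 * (\int[pi]_x (f x ^+ 2) - \int[pi]_x (f x * markov_op k g x)).
  transitivity (\int[pi]_x (f2 x + (- 2 * (f x * markov_op k g x)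
    + markov_op k h x))).
    apply: eq_Rintegral => x _; rewrite /F/=.
    rewrite (bRintD (k1 x)); [|by bmeas..].
    rewrite (bRint_cst (k1 x)) (bRintD (k1 x)); [|by bmeas..].
    rewrite (bRintZ (k1 x)); [|by bmeas].
    by rewrite (bRintZ (k1 x)).
  rewrite (bRintD pi1); [|by bmeas..].
  rewrite (bRintD pi1); [|by bmeas..].
  rewrite (bRintZ pi1); [|by bmeas].
  rewrite (bRint_markov kpi bh) (bRint_markov kpi bf2) /f2; ring.
(* Along the reversal the kernel averages [f] instead, producing [g(x)], so the cross term becomes
   [g^2]. *)
have -> : \int[pi]_x \int[k x]_y F (y, x) =
    2 * (\int[pi]_x (f x ^+ 2) - \int[pi]_x (g x ^+ 2)).
  transitivity (\int[pi]_x (2 * (h x - g x ^+ 2))).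
    apply: eq_Rintegral => x _; rewrite /F/=.
    rewrite (bRintD (k1 x)); [|by bmeas..].
    rewrite (bRintD (k1 x)); [|by bmeas..].
    rewrite (bRintZ (k1 x)); [|by bmeas].
    rewrite (bRint_cst (k1 x)).
    under [X in _ + (_ * X + _)]eq_Rintegral do rewrite mulrC.
    rewrite (bRintZ (k1 x))// -/(markov_op k f x) -/g -/(markov_op k f2 x) -/h.
    by ring.
  rewrite (bRintZ pi1); [|by bmeas].
  rewrite (bRintB pi1); [|by bmeas..].
  by rewrite (bRint_markov kpi bf2).
by rewrite mulrCA ler_pM2l.
Qed.

End edge_dominated.

(** * Cheeger's inequality *)

Lemma measure_bigcup_nd_le {d : measure_display} {T : measurableType d}
    {R : realType} (mu : {measure set T -> \bar R}) (F : (set T)^nat)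
    (b : \bar R) :
  (forall n, measurable (F n)) -> nondecreasing_seq F ->
  (forall n, mu (F n) <= b) -> mu (\bigcup_n F n) <= b.
Proof.
move=> mF ndF Fb.
have h := @nondecreasing_cvg_mu _ _ _ mu _ mF (bigcupT_measurable _ mF) ndF.
rewrite -(cvg_lim _ h)//; apply: lime_le; first by apply/cvg_ex; eexists;
  exact: h.
by apply: nearW => n; exact: Fb.
Qed.

Section median.
Context {d : measure_display} {T : measurableType d} {R : realType}.
Variable P : probability T R.

Lemma measurable_lt_cst (f : T -> R) c : measurable_fun [set: T] f ->
  measurable [set x | (f x < c)%R].
Proof.
move=> mf; have := measurable_fun_ltr mf (measurable_cst c).
by move=> /(_ measurableT [set true]); rewrite setTI; apply.
Qed.

Lemma measurable_gt_cst (f : T -> R) c : measurable_fun [set: T] f ->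
  measurable [set x | (c < f x)%R].
Proof.
move=> mf; have := measurable_fun_ltr (measurable_cst c) mf.
by move=> /(_ measurableT [set true]); rewrite setTI; apply.
Qed.

(** The witness is the supremum of the [t] with [P(f < t) <= 1/2]. Each side is an increasing union
    of sets where [f] stays [1/(n+1)] away from it, and the bound passes to the union. *)
Lemma median_exists (f : T -> R) : bmeas f ->
  exists c : R, P [set x | (f x < c)%R] <= (2^-1)%:E /\
                P [set x | (c < f x)%R] <= (2^-1)%:E.
Proof.
move=> [mf [M fM]].
pose S := [set t : R | P [set x | (f x < t)%R] <= (2^-1)%:E].
have ubS t : S t -> (t <= M + 1)%R.
  rewrite leNgt => St; apply/negP => tM.
  move: St; rewrite /S/= (_ : [set x | _] = [set: T]).
    by rewrite probability_setT lee_fin leNgt invf_lt1 ?ltr1n.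
  apply/seteqP; split => // x _ /=; apply: le_lt_trans tM.
  by rewrite (le_trans (ler_norm _))// (le_trans (fM x))// lerDl.
have S0 : S (- M)%R.
  rewrite /S/= (_ : [set x | _] = set0) ?measure0 ?lee_fin ?invr_ge0//.
  apply/seteqP; split => // x /=; apply/negP; rewrite -leNgt.
  by rewrite lerNl (le_trans _ (fM x))// -normrN ler_norm.
have hS : has_sup S by split; [exists (- M)%R|exists (M + 1)%R].
have e_gt0 n : (0 < n.+1%:R^-1 :> R)%R by [].
have e_le m n : (m <= n)%N -> (n.+1%:R^-1 <= m.+1%:R^-1 :> R)%R.
  by move=> mn; rewrite lef_pV2 ?posrE// ler_nat.
exists (sup S); split.
  pose F n := [set x | (f x < sup S - n.+1%:R^-1)%R].
  have -> : [set x | (f x < sup S)%R] = \bigcup_n F n.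
    apply/seteqP; split => [x /=|x [n _] /=]; last first.
      by move=> /lt_trans; apply; rewrite gtrBl.
    rewrite -subr_gt0 => /ltr_add_invr[n]; rewrite add0r => xn.
    by exists n => //; rewrite /F/= ltrBrDl -ltrBrDr.
  apply: measure_bigcup_nd_le.
  - by move=> n; exact: measurable_lt_cst.
  - move=> m n mn; apply/subsetPset => x /= /lt_le_trans; apply.
    by rewrite lerD2l lerN2 e_le.
  - move=> n; have [s Ss] := sup_adherent (e_gt0 n) hS.
    move=> ns; apply: le_trans Ss; apply: le_measure; rewrite ?inE.
    + exact: measurable_lt_cst.
    + exact: measurable_lt_cst.
    + by move=> x /= /lt_trans; apply.
pose F n := [set x | (sup S + n.+1%:R^-1 <= f x)%R].
have mF n : measurable (F n).
  have -> : F n = ~` [set x | (f x < sup S + n.+1%:R^-1)%R].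
    by apply/seteqP; split => x /=; rewrite /F/= leNgt => /negP.
  by apply: measurableC; exact: measurable_lt_cst.
have -> : [set x | (sup S < f x)%R] = \bigcup_n F n.
  apply/seteqP; split => [x /=|x [n _] /=]; last first.
    by apply: lt_le_trans; rewrite ltrDl.
  by move=> /ltr_add_invr[n] xn; exists n => //; exact: ltW.
apply: measure_bigcup_nd_le => //.
- move=> m n mn; apply/subsetPset => x /=; apply: le_trans.
  by rewrite lerD2l e_le.
- move=> n; have -> : F n = ~` [set x | (f x < sup S + n.+1%:R^-1)%R].
    by apply/seteqP; split => x /=; rewrite /F/= leNgt => /negP.
  rewrite -[X in X <= _]/(P _) probability_setC; last exact: measurable_lt_cst.
  (* A level above the supremum has more than half of the mass strictly below it, hence at most half
     at or above it. *)
  have : ~ S (sup S + n.+1%:R^-1)%R.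
    move=> /(ub_le_sup hS.2); rewrite leNgt => /negP; apply.
    by rewrite ltrDl.
  rewrite /S/= => /negP; rewrite -ltNge => /ltW h.
  rewrite leeBlDr ?fin_num_measure//; last exact: measurable_lt_cst.
  apply: le_trans (leeD2l _ h).
  by rewrite -EFinD lee_fin; lra.
Qed.

End median.

Section edge_probability.
Context {d : measure_display} {T : measurableType d} {R : realType}.
Variables (pi : probability T R) (k : R.-pker T ~> T).
(** This makes the layer-cake formula, stated for probabilities, available on the edge space. *)
HB.instance Definition _ :=
  @Measure_isProbability.Build _ _ _ (edge_measure pi k) (edge_measureT pi k).
End edge_probability.

Section layer_cake.
Context {d : measure_display} {T : measurableType d} {R : realType}.
Variables (P : probability T R) (g : T -> R).
Hypothesis mg : measurable_fun [set: T] g.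

Let X : {RV P >-> R} := HB.pack g (isMeasurableFun.Build _ _ _ _ _ mg).

Let tailE (t : R) : P [set x | (t < g x)%R] = ccdf X t.
Proof. by congr (P _); apply/seteqP; split => x /=; rewrite in_itv/= andbT. Qed.

Lemma measurable_tail : measurable_fun [set: R] (fun t
  => P [set x | (t < g x)%R]).
Proof. by under eq_fun do rewrite tailE; exact: ccdf_measurable. Qed.

Lemma layer_cake : (forall x, (0 <= g x)%R) ->
  \int[P]_x (g x)%:E =
  \int[lebesgue_measure]_(t in `[0%R, +oo[) P [set x | (t < g x)%R].
Proof.
move=> g0; have := @ge0_expectation_ccdf _ _ _ P X g0.
rewrite expectation_def => ->.
by apply: eq_integral => t _; rewrite tailE.
Qed.

End layer_cake.

Section cheeger.
Local Open Scope ring_scope.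
Context {d : measure_display} {T : measurableType d} {R : realType}.
Implicit Types (k : R.-pker T ~> T) (pi : probability T R) (f g : T -> R).

(** The real number [Q(A x B)], written through the operator so that the calculus of bounded
    functions applies; see [edge_measure_flow]. *)
Definition flow pi k (A B : set T) : R :=
  \int[pi]_x (\1_A x * markov_op k \1_B x).

Lemma markov_indic k (A : set T) x : measurable A ->
  markov_op k \1_A x = fine (k x A).
Proof. by move=> mA; rewrite /markov_op bRint_indic. Qed.

Lemma bmeas_flow k (A B : set T) : measurable A -> measurable B ->
  bmeas (fun x => \1_A x * markov_op k \1_B x : R).
Proof.
move=> mA mB; have := bmeas_markov k (bmeas_indic mB) => bB.
by have := bmeas_indic (R := R) mA => bA; bmeas.
Qed.

Lemma edge_measure_flow pi k (A B : set T) : measurable A -> measurable B ->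
  edge_measure pi k (A `*` B) = (flow pi k A B)%:E.
Proof.
move=> mA mB; rewrite edge_measureX//.
rewrite integral_mkcond -bRintE//; last 2 first.
  exact: probability_setT.
  exact: bmeas_flow.
apply: eq_integral => x _; rewrite patchE indicE; case: ifPn => xA.
  rewrite mul1r markov_indic// fineK//.
  rewrite ge0_fin_numE// (@le_lt_trans _ _ 1%E) ?ltry//.
  by rewrite -(@prob_kernel _ _ _ _ _ k x) le_measure ?inE.
by rewrite mul0r.
Qed.

Lemma markov_indicC k (A : set T) x : measurable A ->
  markov_op k \1_(~` A) x = 1 - markov_op k \1_A x.
Proof.
move=> mA; have -> : \1_(~` A) = (fun x => 1 - \1_A x) :> (T -> R).
  by apply/funext => y; rewrite !indicE in_setC; case: (_ \in _);
    rewrite ?subrr ?subr0.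
by rewrite markovB ?markov_cst//; [exact: bmeas_cst|exact: bmeas_indic].
Qed.

Lemma flowC pi k (A B : set T) : measurable A -> measurable B ->
  flow pi k A (~` B) = fine (pi A) - flow pi k A B.
Proof.
move=> mA mB; rewrite /flow -bRint_indic// -bRintB.
- by apply: eq_Rintegral => x _; rewrite markov_indicC// mulrBr mulr1.
- exact: probability_setT.
- exact: bmeas_indic.
- exact: bmeas_flow.
Qed.

(** Coarea argument: [min(g x, g y)] exceeds [t] exactly on [A x A] with [A = {g > t}], and
    [Q(A x A)] is [pi(A)] minus the flow out of [A]. For [t >= 0] this [A] lies in [{g > 0}], so it
    has mass at most [1/2] and [iso] applies; integrate over [t]. *)
Lemma edge_coarea pi k (theta : R) g : 0 <= theta <= 1 ->
  (forall A, measurable A -> fine (pi A) <= 2^-1 ->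
     theta * fine (pi A) <= flow pi k A (~` A)) ->
  bmeas g -> (forall x, 0 <= g x) -> fine (pi [set x | 0 < g x]) <= 2^-1 ->
  theta * \int[pi]_x g x <=
  \int[pi]_x \int[k x]_y (g x - Num.min (g x) (g y)).
Proof.
move=> /andP[theta0 theta1] iso bg g0 pig.
have mg : measurable_fun [set: T] g by case: bg.
have pi1 : pi [set: T] = 1%E by exact: probability_setT.
have k1 x : k x [set: T] = 1%E by exact: prob_kernel.
pose G (z : T * T) := Num.min (g z.1) (g z.2).
have bG : bmeas G by rewrite /G; bmeas.
have mG : measurable_fun [set: T * T] G by case: bG.
have bGint : bmeas (fun x => \int[k x]_y G (x, y)).
  exact: bmeas_edge.
suff : \int[edge_measure pi k]_z G z <= (1 - theta) * \int[pi]_x g x.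
  rewrite bRint_edge// => h.
  have -> : \int[pi]_x \int[k x]_y (g x - Num.min (g x) (g y)) =
     \int[pi]_x g x - \int[pi]_x \int[k x]_y G (x, y).
    rewrite -(bRintB pi1)//; apply: eq_Rintegral => x _.
    rewrite (bRintB (k1 x)); [|by bmeas..].
    by rewrite (bRint_cst (k1 x)).
  by lra.
rewrite -lee_fin EFinM -!bRintE//; last exact: edge_measureT.
rewrite !layer_cake//; last by move=> z; rewrite le_min !g0.
have mtail : measurable_fun (`[0, +oo[%classic : set R)
    (fun t => pi [set x | t < g x]).
  by apply: measurable_funTS; exact: measurable_tail.
rewrite -ge0_integralZl//; last by rewrite lee_fin subr_ge0.
apply: ge0_le_integral => //.
- by apply: measurable_funTS; exact: measurable_tail.
- by apply: emeasurable_funM.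
move=> t /=; rewrite in_itv/= andbT => t0.
pose A := [set x | t < g x].
have mA : measurable A by exact: measurable_gt_cst.
have -> : [set z | t < G z] = A `*` A.
  apply/seteqP; split => -[x y]; rewrite /G/= lt_min.
    by move=> /andP[].
  by move=> [? ?]; apply/andP.
rewrite -[X in (X <= _)%E]/(edge_measure pi k (A `*` A)).
rewrite edge_measure_flow// -[pi _]fineK ?fin_num_measure// -EFinM lee_fin.
have := iso A mA; rewrite flowC//.
have : fine (pi A) <= fine (pi [set x | 0 < g x]).
  rewrite fine_le ?fin_num_measure//; first exact: measurable_gt_cst.
  apply: le_measure; rewrite ?inE//; first exact: measurable_gt_cst.
  by move=> x /=; exact: le_lt_trans.
by move=> /le_trans/(_ pig) h /(_ h); rewrite /A; lra.
Qed.

(** The left side collects the decreases, from [a] to [b], of the squared positive and negative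
    parts. Each is at most a product [u * v] with [u = +-(a - b)]; the weights in [amgm] are chosen
    so that the last term integrates to half of [theta * V] in [cheeger]. *)
Lemma cheeger_pointwise (theta a b : R) : 0 < theta ->
  (Num.max a 0 ^+ 2 - Num.min (Num.max a 0 ^+ 2) (Num.max b 0 ^+ 2)) +
  (Num.max (- a) 0 ^+ 2 - Num.min (Num.max (- a) 0 ^+ 2) (Num.max (- b) 0 ^+ 2))
  <= 2 / theta * (a - b) ^+ 2 + theta / 4 * (a ^+ 2 + b ^+ 2).
Proof.
move=> t0.
have amgm u v : u * v <= 2 / theta * u ^+ 2 + theta / 8 * v ^+ 2.
  have : 0 <= theta / 8 * (4 / theta * u - v) ^+ 2.
    by rewrite mulr_ge0 ?sqr_ge0// divr_ge0// ltW.
  suff -> : theta / 8 * (4 / theta * u - v) ^+ 2 =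
    2 / theta * u ^+ 2 + theta / 8 * v ^+ 2 - u * v by rewrite subr_ge0.
  by field; rewrite gt_eqF.
have par (v : R) : v ^+ 2 <= 2 * (a ^+ 2 + b ^+ 2) ->
    theta / 8 * v ^+ 2 <= theta / 4 * (a ^+ 2 + b ^+ 2).
  move=> h; have -> : theta / 4 * (a ^+ 2 + b ^+ 2) =
    theta / 8 * (2 * (a ^+ 2 + b ^+ 2)) by field.
  by rewrite ler_pM2l// divr_gt0.
have key (u v X : R) : X <= u * v -> u ^+ 2 = (a - b) ^+ 2 ->
    v ^+ 2 <= 2 * (a ^+ 2 + b ^+ 2) ->
    X <= 2 / theta * (a - b) ^+ 2 + theta / 4 * (a ^+ 2 + b ^+ 2).
  move=> h1 h2 h3; apply: (le_trans h1); apply: (le_trans (amgm u v)).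
  by rewrite h2 lerD2l par.
have p1 : (a + b) ^+ 2 <= 2 * (a ^+ 2 + b ^+ 2).
  rewrite -subr_ge0 (_ : _ - _ = (a - b) ^+ 2) ?sqr_ge0//; ring.
have p2 : (a - b) ^+ 2 <= 2 * (a ^+ 2 + b ^+ 2).
  rewrite -subr_ge0 (_ : _ - _ = (a + b) ^+ 2) ?sqr_ge0//; ring.
have p3 : (b - a) ^+ 2 <= 2 * (a ^+ 2 + b ^+ 2).
  by rewrite -sqrrN opprB.
have p4 : (- (a + b)) ^+ 2 <= 2 * (a ^+ 2 + b ^+ 2) by rewrite sqrrN.
have e1 : (b - a) ^+ 2 = (a - b) ^+ 2 by ring.
have pos : 0 <= 2 / theta * (a - b) ^+ 2 + theta / 4 * (a ^+ 2 + b ^+ 2).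
  by rewrite addr_ge0// mulr_ge0 ?addr_ge0 ?sqr_ge0// divr_ge0// ltW.
(* With equal signs the difference of squares factors, or the minimum kills it; with opposite signs
   [a^2 <= (a - b)^2]. *)
have [a0|a0] := leP a 0; have [b0|b0] := leP b 0.
- rewrite (max_idPl (_ : 0 <= - a)) ?oppr_ge0// (max_idPl (_ : 0
    <= - b)) ?oppr_ge0//.
  rewrite expr0n/= minxx subrr add0r !sqrrN.
  have [ab|ab] := leP (a ^+ 2) (b ^+ 2); first by rewrite subrr.
  by apply: (key (b - a) (- (a + b))) => //; (rewrite le_eqVlt; apply/orP;
    left; apply/eqP; ring).
- rewrite (max_idPl (_ : 0 <= - a)) ?oppr_ge0// (max_idPr (_ : - b <= 0));
    last by rewrite oppr_le0 ltW.
  rewrite expr0n/= !sqrrN (min_idPl (_ : 0 <= b ^+ 2)) ?sqr_ge0//.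
  rewrite (min_idPr (_ : 0 <= a ^+ 2)) ?sqr_ge0// subrr add0r subr0.
  by apply: (key (b - a) (b - a)) => //; nra.
- rewrite (max_idPl (_ : 0 <= - b)) ?oppr_ge0// (max_idPr (_ : - a <= 0));
    last by rewrite oppr_le0 ltW.
  rewrite expr0n/= !sqrrN (min_idPr (_ : 0 <= a ^+ 2)) ?sqr_ge0//.
  rewrite (min_idPl (_ : 0 <= b ^+ 2)) ?sqr_ge0// subrr addr0 subr0.
  by apply: (key (a - b) (a - b)) => //; nra.
- rewrite (max_idPr (_ : - a <= 0)) ?oppr_le0 ?(ltW a0)//.
  rewrite (max_idPr (_ : - b <= 0)) ?oppr_le0 ?(ltW b0)//.
  rewrite expr0n/= minxx subrr addr0.
  have [ab|ab] := leP (a ^+ 2) (b ^+ 2); first by rewrite subrr.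
  by apply: (key (a - b) (a + b)) => //; (rewrite le_eqVlt; apply/orP; left;
    apply/eqP; ring).
Qed.

(** Centring [f] at a median [c] leaves mass at most [1/2] on each side, so [edge_coarea] applies to
    both squared parts of [phi = f - c]. Summing them and using [cheeger_pointwise] bounds
    [theta * V] by the energy plus a part absorbed on the left. *)
Lemma cheeger pi k (theta : R) f : invariant_measure k pi -> 0 < theta <= 1 ->
  (forall A, measurable A -> fine (pi A) <= 2^-1 ->
     theta * fine (pi A) <= flow pi k A (~` A)) ->
  bmeas f ->
  theta ^+ 2 / 8 * (\int[pi]_x (f x ^+ 2) - (\int[pi]_x f x) ^+ 2) <=
  \int[pi]_x (f x ^+ 2) - \int[pi]_x (f x * markov_op k f x).
Proof.
move=> kpi /andP[t0 t1] iso bf.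
(* Absorption: subtract [theta / 2 * v] and multiply by [theta / 4]. *)
have alg (v e : R) : theta * v <= 4 / theta * e + theta / 2 * v ->
    theta ^+ 2 / 8 * v <= e.
  move=> h; have : theta / 4 * (theta / 2 * v) <= theta / 4 * (4 / theta * e).
    by rewrite ler_pM2l ?divr_gt0//; lra.
  have -> : theta / 4 * (4 / theta * e) = e by field; rewrite gt_eqF.
  by have -> : theta / 4 * (theta / 2 * v) = theta ^+ 2 / 8 * v by field.
have [c [cl cr]] := median_exists pi bf.
have pi1 : pi [set: T] = 1%E by exact: probability_setT.
have k1 x : k x [set: T] = 1%E by exact: prob_kernel.
pose phi x := f x - c.
have bphi : bmeas phi by rewrite /phi; bmeas.
have mphi : measurable_fun [set: T] phi by case: bphi.
pose g1 x := Num.max (phi x) 0 ^+ 2.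
pose g2 x := Num.max (- phi x) 0 ^+ 2.
have bg1 : bmeas g1 by rewrite /g1; bmeas.
have bg2 : bmeas g2 by rewrite /g2; bmeas.
have t01 : 0 <= theta <= 1 by rewrite t1 ltW.
have pos_sq (u : R) : (0 < Num.max u 0 ^+ 2) = (0 < u).
  have [u0|u0] := leP u 0; first by rewrite expr0n/= ltxx.
  by rewrite exprn_gt0.
have half (A B : set T) : A = B -> (pi B <= (2^-1)%:E)%E -> fine (pi A) <= 2^-1.
  move=> ->; case: (pi B) (@measure_ge0 _ _ _ pi B) => //=.
have mf : measurable_fun [set: T] f by case: bf.
have h1 : fine (pi [set x | 0 < g1 x]) <= 2^-1.
  apply: half cr; apply/seteqP; split=> x /=; by rewrite /g1 pos_sq subr_gt0.
have h2 : fine (pi [set x | 0 < g2 x]) <= 2^-1.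
  apply: half cl; apply/seteqP; split=> x /=;
    by rewrite /g2 pos_sq oppr_gt0 subr_lt0.
have := edge_coarea t01 iso bg1 (fun x => sqr_ge0 _) h1.
have := edge_coarea t01 iso bg2 (fun x => sqr_ge0 _) h2.
pose F (z : T * T) := 2 / theta * (phi z.1 - phi z.2) ^+ 2 + theta
  / 4 * (phi z.1 ^+ 2 + phi z.2 ^+ 2).
pose G1 (z : T * T) := g1 z.1 - Num.min (g1 z.1) (g1 z.2).
pose G2 (z : T * T) := g2 z.1 - Num.min (g2 z.1) (g2 z.2).
have bF : bmeas F by rewrite /F; bmeas.
have bG1 : bmeas G1 by rewrite /G1; bmeas.
have bG2 : bmeas G2 by rewrite /G2; bmeas.
pose V := \int[pi]_x (phi x ^+ 2).
have Vsum : \int[pi]_x g1 x + \int[pi]_x g2 x = V.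
  rewrite -(bRintD pi1)//; apply: eq_Rintegral => x _; rewrite /g1 /g2.
  have [u0|u0] := leP (phi x) 0.
    by rewrite (max_idPl (_ : 0 <= - phi x)) ?oppr_ge0// expr0n/= add0r sqrrN.
  rewrite (max_idPr (_ : - phi x <= 0)) ?oppr_le0 ?(ltW u0)//.
  by rewrite expr0n/= addr0.
have GF : \int[pi]_x \int[k x]_y G1 (x, y) + \int[pi]_x \int[k x]_y G2 (x, y) <=
    \int[pi]_x \int[k x]_y F (x, y).
  rewrite -!bRint_edge// -(bRintD (edge_measureT pi k))//.
  apply: (le_bRint (edge_measureT pi k)) => //; first by bmeas.
  by move=> z; exact: cheeger_pointwise.
pose D := \int[pi]_x (f x ^+ 2) - \int[pi]_x (f x * markov_op k f x).
have bPf : bmeas (markov_op k f) by exact: bmeas_markov.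
pose f2 x := f x ^+ 2.
have bf2 : bmeas f2 by rewrite /f2; bmeas.
pose phi2 x := phi x ^+ 2.
have bphi2 : bmeas phi2 by rewrite /phi2; bmeas.
have bPf2 : bmeas (markov_op k f2) by exact: bmeas_markov.
have bPphi2 : bmeas (markov_op k phi2) by exact: bmeas_markov.
have FE : \int[pi]_x \int[k x]_y F (x, y) = 4 / theta * D + theta / 2 * V.
  transitivity (\int[pi]_x (2 / theta * (f2 x - 2 * (f x * markov_op k f x)
    + markov_op k f2 x)
      + theta / 4 * (phi2 x + markov_op k phi2 x))).
    apply: eq_Rintegral => x _.
    transitivity (\int[k x]_y (2 / theta * (f2 x - 2 * (f x * f y) + f2 y)
      + theta / 4 * (phi2 x + phi2 y))).
      by apply: eq_Rintegral => y _; rewrite /F /f2 /phi2 /phi/=; ring.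
    rewrite (bRintD (k1 x)); [|by bmeas..].
    rewrite (bRintZ (k1 x)); [|by bmeas].
    rewrite (bRintD (k1 x)); [|by bmeas..].
    rewrite (bRintZ (k1 x)); [|by bmeas].
    rewrite (bRintD (k1 x)); [|by bmeas..].
    rewrite (bRintB (k1 x)); [|by bmeas..].
    do 2 (rewrite (bRintZ (k1 x)); [|by bmeas]).
    by rewrite !(bRint_cst (k1 x)).
  rewrite (bRintD pi1); [|by bmeas..].
  rewrite (bRintZ pi1); [|by bmeas].
  rewrite (bRintD pi1); [|by bmeas..].
  rewrite (bRintZ pi1); [|by bmeas].
  rewrite (bRintD pi1); [|by bmeas..].
  rewrite (bRintB pi1); [|by bmeas..].
  rewrite (bRintZ pi1); [|by bmeas].
  rewrite !(bRint_markov kpi)// -/V /D /f2.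
  by field; rewrite gt_eqF.
move=> i2 i1.
have h : theta * V <= 4 / theta * D + theta / 2 * V.
  have := lerD i1 i2; rewrite -mulrDr Vsum => /le_trans; apply.
  by rewrite -FE; exact: GF.
have h' := alg _ _ h.
apply: le_trans h'; rewrite ler_wpM2l//; first by rewrite divr_ge0 ?sqr_ge0.
(* The second moment about [c] is the variance plus [(m - c)^2]. *)
have -> : V = \int[pi]_x (f x ^+ 2) - 2 * c * \int[pi]_x f x + c ^+ 2.
  transitivity (\int[pi]_x (f x ^+ 2 - 2 * c * f x + c ^+ 2)).
    by apply: eq_Rintegral => x _; rewrite /phi; ring.
  rewrite (bRintD pi1); [|by bmeas..].
  rewrite (bRintB pi1); [|by bmeas..].
  by rewrite (bRintZ pi1)// (bRint_cst pi1).
rewrite -subr_ge0; set m := \int[pi]_x f x.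
rewrite (_ : _ - _ = (m - c) ^+ 2) ?sqr_ge0//; ring.
Qed.

End cheeger.

(** * Isoperimetry of two steps *)

Section isoperimetry.
Local Open Scope ring_scope.
Context {d : measure_display} {T : measurableType d} {R : realType}.
Implicit Types (p k : R.-pker T ~> T) (pi : probability T R) (f g : T -> R).

Lemma nontrivial_fine pi (A : set T) : nontrivial_set pi A -> 0 < fine (pi A)
  < 1.
Proof.
move=> [mA /andP[A0 A1]].
by rewrite -!lte_fin fineK ?fin_num_measure// A0.
Qed.

Lemma isoperimetric_ratioE p pi m (A : set T) : nontrivial_set pi A ->
  isoperimetric_ratio p pi m A =
  (flow pi (kiter p m) A (~` A) / (fine (pi A) * (1 - fine (pi A))))%:E.
Proof.
move=> ntA; have [mA _] := ntA; have /andP[a0 a1] := nontrivial_fine ntA.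
have mAc := measurableC mA.
rewrite /isoperimetric_ratio -edge_measureX// edge_measure_flow//.
rewrite probability_setC// -[pi A]fineK ?fin_num_measure//.
by rewrite -EFinB -EFinM inver mulf_eq0 !gt_eqF ?subr_gt0//= EFinM.
Qed.

Lemma markov_indic01 k (A : set T) x : measurable A ->
  0 <= markov_op k \1_A x <= 1.
Proof.
move=> mA; rewrite Rintegral_ge0//= -[leRHS](markov_cst k 1 x).
apply: le_markov; [exact: bmeas_indic|by bmeas|].
by move=> y; rewrite indicE; case: (_ \in _).
Qed.

Lemma flow_ge0 pi k (A B : set T) : measurable B -> 0 <= flow pi k A B.
Proof.
move=> mB; apply: Rintegral_ge0 => x _; rewrite mulr_ge0//.
by case/andP: (markov_indic01 k x mB).
Qed.

(** Take [f = (1_A - a) / s] with [s^2 = a (1 - a)] the variance of [1_A]. The same [f] serves all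
    invariant kernels, so different [k_m(A)] can be compared through it. *)
Lemma normalized_indicator pi (A : set T) : nontrivial_set pi A ->
  exists f : T -> R, [/\ bmeas f, \int[pi]_x f x = 0,
    \int[pi]_x (f x ^+ 2) = 1 &
    forall k, invariant_measure k pi ->
    \int[pi]_x (f x * markov_op k f x) =
    1 - flow pi k A (~` A) / (fine (pi A) * (1 - fine (pi A)))].
Proof.
move=> ntA; have [mA _] := ntA; have /andP[] := nontrivial_fine ntA.
set a := fine (pi A) => a0 a1.
have pi1 : pi [set: T] = 1%E by exact: probability_setT.
have v0 : 0 < a * (1 - a) by rewrite mulr_gt0// subr_gt0.
pose s := Num.sqrt (a * (1 - a)).
have s0 : s != 0 by rewrite gt_eqF// sqrtr_gt0.
have ss : s ^+ 2 = a * (1 - a) by rewrite sqr_sqrtr// ltW.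
have bA := @bmeas_indic _ _ R A mA.
have AE : \int[pi]_x (\1_A x : R) = a by rewrite bRint_indic.
pose f x := s^-1 * (\1_A x - a).
have bf : bmeas f by rewrite /f; bmeas.
exists f; split => //.
- rewrite (bRintZ pi1); [|by bmeas].
  rewrite (bRintB pi1)//; [|by bmeas].
  by rewrite AE (bRint_cst pi1) subrr mulr0.
- transitivity (\int[pi]_x ((s ^+ 2)^-1 * ((1 - 2 * a) * \1_A x + a ^+ 2))).
    apply: eq_Rintegral => x _; rewrite /f exprMn exprVn; congr (_ * _).
    by rewrite indicE; case: (_ \in _) => /=; ring.
  rewrite (bRintZ pi1); [|by bmeas].
  rewrite (bRintD pi1); [|by bmeas..].
  rewrite (bRintZ pi1)// AE (bRint_cst pi1) ss.
  by field; rewrite (gt_eqF a0) subr_eq0 gt_eqF.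
move=> k kpi; have bPA : bmeas (markov_op k \1_A) := bmeas_markov k bA.
rewrite flowC// -/a -ss.
transitivity (\int[pi]_x ((s ^+ 2)^-1 * (\1_A x * markov_op k \1_A x - a *
  \1_A x - a * markov_op k \1_A x + a ^+ 2))).
  apply: eq_Rintegral => x _; rewrite /f.
  rewrite markovZ; [|by bmeas]; rewrite markovB; [|by bmeas..].
  by rewrite markov_cst; field.
rewrite (bRintZ pi1); [|by bmeas].
rewrite (bRintD pi1); [|by bmeas..].
rewrite (bRintB pi1); [|by bmeas..].
rewrite (bRintB pi1); [|by bmeas..].
do 2 (rewrite (bRintZ pi1); [|by bmeas]).
rewrite (bRint_markov kpi bA) AE (bRint_cst pi1) -/(flow pi k A A).
have -> : a - flow pi k A A = s ^+ 2 + a ^+ 2 - flow pi k A A by rewrite ss;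
  ring.
by field.
Qed.

(** Here [a], [b], [u], [i] are the masses of [A], [B], their union and their intersection, and [e]
    is the mass leaving [A] in two steps, so [eps] is the two-step ratio of [A]. The bounds [kap]
    and [K] on the one-step ratios force [eps] to be large. *)
Lemma two_step_arith (C kap K a u i b e : R) :
  0 < C -> 0 < kap -> 0 < a < 1 -> 0 <= i -> a <= u <= 1 -> i <= a -> u + i
    = a + b ->
  0 <= K <= 2 ->
  kap * (u * (1 - u)) <= (4 * C + 2) * e ->
  kap * (i * (1 - i)) <= (4 * C + 2) * e ->
  0 <= e ->
  b <= a + 2 * C * e -> a - i - 2 * C * e <= K * (a * (1 - a)) ->
  (2 - K) / (4 * (2 * C + (4 * C + 2) / kap)) <= e / (a * (1 - a)).
Proof.
move=> C0 kap0 /andP[a0 a1] i0 /andP[au u1] ia ui /andP[K0 K2] hu hi e0 hb hA.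
have a'0 : 0 < 1 - a by lra.
have v0 : 0 < a * (1 - a) by rewrite mulr_gt0.
set c := (4 * C + 2) / kap.
have c0 : 0 < c by rewrite divr_gt0// addr_gt0// mulr_gt0.
set eps := e / (a * (1 - a)).
have eE : e = eps * (a * (1 - a)) by rewrite /eps divfK// gt_eqF.
have eps0 : 0 <= eps by rewrite divr_ge0// ltW.
have step (X : R) : kap * X <= (4 * C + 2) * e -> X <= c * e.
  by move=> h; rewrite /c mulrAC ler_pdivlMr// mulrC.
(* Since [u >= a], the factor [u] in [u (1 - u)] can be traded for [a]; [hI] trades [1 - i] for
   [1 - a] likewise. *)
have hU : 1 - u <= c * eps * (1 - a).
  have h := step _ hu.
  have h1 : a * (1 - u) <= a * (c * eps * (1 - a)).
    apply: (@le_trans _ _ (u * (1 - u))); first by rewrite ler_wpM2r//; lra.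
    apply: (le_trans h); rewrite eE.
    by rewrite (_ : c * _ = a * (c * eps * (1 - a)))//; ring.
  by rewrite ler_pM2l in h1.
have hI : i <= c * eps * a.
  have h := step _ hi.
  have h1 : (1 - a) * i <= (1 - a) * (c * eps * a).
    apply: (@le_trans _ _ (i * (1 - i))).
      by rewrite mulrC ler_wpM2l//; lra.
    apply: (le_trans h); rewrite eE.
    by rewrite (_ : c * _ = (1 - a) * (c * eps * a))//; ring.
  by rewrite ler_pM2l in h1.
have Ce0 : 0 <= C * eps by rewrite mulr_ge0// ltW.
have ce0 : 0 <= c * eps by rewrite mulr_ge0// ltW.
have Cea : C * eps * a <= C * eps by rewrite -[leRHS]mulr1 ler_wpM2l// ltW.
have Cea0 : 0 <= C * eps * a by rewrite mulr_ge0// ltW.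
have Ceaa : C * eps * a * (1 - a) <= C * eps * a.
  by rewrite -[leRHS]mulr1 ler_wpM2l//; lra.
have hK : 1 - (2 * C + c) * eps <= K * (1 - a).
  have h1 : a * (1 - (2 * C + c) * eps) <= a * (K * (1 - a)).
    rewrite (_ : a * (K * (1 - a)) = K * (a * (1 - a))); last by ring.
    apply: le_trans hA.
    rewrite eE (_ : _ - 2 * C * _ = a - i - 2 * (C * eps * a * (1 - a)));
      last by ring.
    rewrite (_ : a * _ = a - 2 * (C * eps * a) - c * eps * a); last by ring.
    lra.
  by rewrite ler_pM2l in h1.
(* [A] cannot be much smaller than one half: [u] is nearly one, while [u + i = a + b] and [b] hardly
   exceeds [a]. *)
have h2a : 2 * (1 - a) <= 1 + (2 * C + c) * eps.
  have ca : c * eps * (1 - a) <= c * eps.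
    by rewrite -[leRHS]mulr1 ler_wpM2l//; lra.
  have : 2 * C * e <= 2 * (C * eps).
    rewrite eE (_ : 2 * C * _ = 2 * (C * eps * a * (1 - a))); last by ring.
    lra.
  rewrite (_ : (2 * C + c) * eps = 2 * (C * eps) + c * eps); last by ring.
  by move: hb hU ca ui i0; clear; lra.
set c2 := 2 * C + c in hK h2a *.
have c20 : 0 < c2 by rewrite /c2; lra.
rewrite ler_pdivrMr ?mulr_gt0//.
have x0 : 0 <= c2 * eps by rewrite mulr_ge0// ltW.
(* Chain [2 (1 - c2 eps) <= 2 K (1 - a) <= K (1 + c2 eps)]; with [K <= 2] this gives
   [2 - K <= 4 c2 eps]. *)
have : K * (2 * (1 - a)) <= K * (1 + c2 * eps) by rewrite ler_wpM2l.
have : K * (c2 * eps) <= 2 * (c2 * eps) by rewrite ler_wpM2r.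
rewrite (_ : eps * (4 * c2) = 4 * (c2 * eps)); last by ring.
move: hK; rewrite mulrDr mulr1 (_ : K * (2 * (1 - a)) = 2 * (K * (1 - a)));
  last by ring.
by clear; lra.
Qed.

Lemma orb_andb (b1 b2 : bool) :
  (b1 || b2)%:R + (b1 && b2)%:R = b1%:R + b2%:R :> R.
Proof. by case: b1; case: b2; rewrite ?addr0 ?add0r. Qed.

Lemma andb_ge (b1 b2 : bool) : b1%:R + b2%:R - 1 <= (b1 && b2)%:R :> R.
Proof. by case: b1; case: b2 => /=; lra. Qed.

Lemma andb_overlap_le (b1 b2 : bool) (u : R) :
  b1%:R * u <= (b1 && b2)%:R + `|u - b2%:R|.
Proof.
have := ler_norm (u - b2%:R); have := normr_ge0 (u - b2%:R).
by case: b1; case: b2 => /=; lra.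
Qed.

(** Used at a point [x] with [b1], [b2] the indicators of [A], [B], and [u], [v], [w] the values of
    [P 1_A], [P 1_B] and [P] of the union. From [A] the chain goes nearly surely to [B], and from
    [B] to [A]; each case is paid by one of the two errors. *)
Lemma orb_defect_le (b1 b2 : bool) (u v w : R) : u <= w -> v <= w ->
  (b1 || b2)%:R * (1 - w) <= `|v - b1%:R| + `|u - b2%:R|.
Proof.
have := ler_norm (- (v - b1%:R)); have := normr_ge0 (v - b1%:R).
have := ler_norm (- (u - b2%:R)); have := normr_ge0 (u - b2%:R).
by rewrite !normrN; case: b1; case: b2 => /=; lra.
Qed.

(** The analogue for the intersection: missing it means missing [A] or missing [B], a union
    bound. *)
Lemma andb_defect_le (b1 b2 : bool) (u v w : R) : u + v - 1 <= w ->
  (b1 && b2)%:R * (1 - w) <= `|v - b1%:R| + `|u - b2%:R|.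
Proof.
have := ler_norm (- (v - b1%:R)); have := normr_ge0 (v - b1%:R).
have := ler_norm (- (u - b2%:R)); have := normr_ge0 (u - b2%:R).
by rewrite !normrN; case: b1; case: b2 => /=; lra.
Qed.

Section two_step.
Variables (pi : probability T R) (k : R.-pker T ~> T) (C : R).
Hypothesis kpi : invariant_measure k pi.
Hypothesis C0 : 0 < C.
Hypothesis domk : edge_dominated pi k C.

Lemma two_step_isoperimetry (kap K : R) : 0 < kap -> K < 2 ->
  (forall A, nontrivial_set pi A ->
    kap <= flow pi k A (~` A) / (fine (pi A) * (1 - fine (pi A))) <= K) ->
  forall A, nontrivial_set pi A ->
  (2 - K) / (4 * (2 * C + (4 * C + 2) / kap)) <=
  (\int[pi]_x (\1_A x * markov_op k (markov_op k \1_(~` A)) x)) /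
  (fine (pi A) * (1 - fine (pi A))).
Proof.
move=> kap0 K2 iso A ntA; have [mA _] := ntA.
have k1 x : k x [set: T] = 1%E by exact: prob_kernel.
have pi1 : pi [set: T] = 1%E by exact: probability_setT.
have mAc := measurableC mA.
(* The union and intersection used below may be null or full; then the left side is zero. *)
have iso_le U : measurable U ->
    kap * (fine (pi U) * (1 - fine (pi U))) <= flow pi k U (~` U).
  move=> mU; have [ntU|ntU] := pselect (nontrivial_set pi U).
    have /andP[h _] := iso _ ntU; have /andP[u0 u1] := nontrivial_fine ntU.
    by rewrite ler_pdivlMr ?mulr_gt0 ?subr_gt0// in h.
  have -> : fine (pi U) * (1 - fine (pi U)) = 0.
    apply/eqP; rewrite mulf_eq0 subr_eq0; apply: contrapT => /negP.
    rewrite negb_or => /andP[u0 u1]; apply: ntU; split => //.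
    rewrite lt0e measure_ge0 andbT lt_neqAle probability_le1// andbT.
    rewrite -[pi U]fineK ?fin_num_measure// !eqe u0/=.
    by rewrite eq_sym.
  by rewrite mulr0 flow_ge0//; exact: measurableC.
have /andP[a0 a1] := nontrivial_fine ntA.
have /andP[_ hKA] := iso _ ntA.
have v0 : 0 < fine (pi A) * (1 - fine (pi A)) by rewrite mulr_gt0 ?subr_gt0.
rewrite ler_pdivrMr// in hKA.
have K0 : 0 <= K.
  by rewrite -(pmulr_lge0 _ v0); apply: le_trans hKA; exact: flow_ge0.
rewrite flowC// in hKA.
have bA := @bmeas_indic _ _ R A mA.
set g := markov_op k \1_A; have bg : bmeas g by exact: bmeas_markov.
have g01 x : 0 <= g x <= 1 by exact: markov_indic01.
pose B := [set x | 2^-1 < g x].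
have mB : measurable B by apply: measurable_gt_cst; case: bg.
have bB := @bmeas_indic _ _ R B mB.
have bPg : bmeas (markov_op k g) by exact: bmeas_markov.
have bPB : bmeas (markov_op k \1_B) by exact: bmeas_markov.
have cE : markov_op k \1_(~` A) = (fun x => 1 - g x).
  by apply/funext => x; rewrite markov_indicC.
have PcE x : markov_op k (markov_op k \1_(~` A)) x = 1 - markov_op k g x.
  by rewrite cE markovB ?markov_cst//; bmeas.
set e := \int[pi]_x _.
have Pg01 x : 0 <= markov_op k g x <= 1.
  rewrite Rintegral_ge0/=; last by move=> y _; case/andP: (g01 y).
  rewrite -[leRHS](markov_cst k 1 x); apply: le_markov => //; first by bmeas.
  by move=> y; case/andP: (g01 y).
have eE : e = fine (pi A) - \int[pi]_x (\1_A x * markov_op k g x).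
  rewrite -bRint_indic// -(bRintB pi1)//; last by bmeas.
  by apply: eq_Rintegral => x _; rewrite PcE mulrBr mulr1.
have e0 : 0 <= e.
  apply: Rintegral_ge0 => x _; rewrite PcE mulr_ge0// subr_ge0.
  by case/andP: (Pg01 x).
(* [Q <= C Q~] tested on [(x, y) |-> 1_A(y) (1 - g(x))]. *)
have gg : \int[pi]_x (g x * (1 - g x)) <= C * e.
  pose F (z : T * T) : R := \1_A z.2 * (1 - g z.1).
  have bF : bmeas F by rewrite /F; bmeas.
  have F0 z : 0 <= F z.
    by rewrite mulr_ge0// subr_ge0; case/andP: (g01 z.1).
  have := domk bF F0.
  rewrite (_ : \int[pi]_x \int[k x]_y F (x, y)
    = \int[pi]_x (g x * (1 - g x))); last first.
    apply: eq_Rintegral => x _; rewrite /F/=.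
    under eq_Rintegral do rewrite mulrC.
    by rewrite (bRintZ (k1 x))// mulrC.
  rewrite (_ : \int[pi]_x \int[k x]_y F (y, x) = e)//.
  apply: eq_Rintegral => x _; rewrite /F/= PcE.
  rewrite (bRintZ (k1 x)); last by bmeas.
  by rewrite -[X in _ * X = _]/(markov_op k (fun y
    => 1 - g y) x) markovB ?markov_cst//; bmeas.
(* Rounding at [1/2] costs [min(g, 1 - g)], and the larger of [g] and [1 - g] is at least [1/2]. *)
have gB : \int[pi]_x `|g x - \1_B x| <= 2 * C * e.
  apply: (@le_trans _ _ (\int[pi]_x (2 * (g x * (1 - g x))))).
    apply: (le_bRint pi1); [by bmeas|by bmeas|] => x.
    have /andP[gx0 gx1] := g01 x.
    rewrite indicE; have [xB|xB] := boolP (x \in B).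
      have : 2^-1 < g x by move: xB; rewrite inE.
      by move=> h; rewrite ler0_norm ?subr_le0//= opprB; nra.
    have : g x <= 2^-1 by rewrite leNgt; apply/negP; move: xB;
      rewrite notin_setE.
    by move=> h; rewrite subr0 ger0_norm//; nra.
  rewrite (bRintZ pi1); last by bmeas.
  by rewrite -mulrA ler_pM2l.
(* Mass [e] leaves [A] in two steps and, by invariance, as much enters it. *)
have gA : \int[pi]_x `|markov_op k g x - \1_A x| = 2 * e.
  transitivity (\int[pi]_x (\1_A x
    + markov_op k g x - 2 * (\1_A x * markov_op k g x))).
    apply: eq_Rintegral => x _; have /andP[h0 h1] := Pg01 x.
    rewrite indicE; case: (_ \in _) => /=.
      by rewrite ler0_norm ?subr_le0//; ring.
    by rewrite subr0 ger0_norm//; ring.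
  rewrite (bRintB pi1); [|by bmeas..].
  rewrite (bRintD pi1)//.
  rewrite (bRintZ pi1); [|by bmeas].
  rewrite (bRint_markov kpi bg) (bRint_markov kpi bA) bRint_indic// eE.
  by ring.
(* [P] contracts in [L^1], so [P 1_B] is as close to [P g] as [1_B] is to [g]; then add [gA]. *)
have BA : \int[pi]_x `|markov_op k \1_B x - \1_A x| <= 2 * C * e + 2 * e.
  pose q x := `|g x - \1_B x|.
  have bq : bmeas q by rewrite /q; bmeas.
  have bPq : bmeas (markov_op k q) by exact: bmeas_markov.
  apply: (@le_trans _ _ (\int[pi]_x (markov_op k q x
    + `|markov_op k g x - \1_A x|))).
    apply: (le_bRint pi1); [by bmeas|by bmeas|] => x.
    have : markov_op k g x - markov_op k \1_B x <= markov_op k q x.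
      rewrite -markovB//; apply: le_markov => //; first by bmeas.
      by move=> y; exact: ler_norm.
    have : markov_op k \1_B x - markov_op k g x <= markov_op k q x.
      rewrite -markovB//; apply: le_markov => //; first by bmeas.
      by move=> y; rewrite /q distrC; exact: ler_norm.
    move=> h1 h2.
    apply: (le_trans (ler_distD (markov_op k g x) _ _)); rewrite lerD2r.
    by rewrite ler_norml; apply/andP; split; lra.
  rewrite (bRintD pi1); [|by bmeas..].
  by rewrite (bRint_markov kpi bq) gA lerD2r.
pose q x := `|markov_op k \1_B x - \1_A x| + `|g x - \1_B x|.
have bq : bmeas q by rewrite /q; bmeas.
have qE : \int[pi]_x q x <= (4 * C + 2) * e.
  rewrite (bRintD pi1); [|by bmeas..].
  by apply: (le_trans (lerD BA gB)); rewrite le_eqVlt; apply/orP; left;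
    apply/eqP; ring.
pose U := A `|` B; pose I := A `&` B.
have mU : measurable U by exact: measurableU.
have mI : measurable I by exact: measurableI.
have bU := @bmeas_indic _ _ R U mU.
have bI := @bmeas_indic _ _ R I mI.
have flowcE S : measurable S -> flow pi k S (~` S) =
    \int[pi]_x (\1_S x * (1 - markov_op k \1_S x)).
  by move=> mS; apply: eq_Rintegral => x _; rewrite markov_indicC.
have bPU := bmeas_markov k bU.
have bPI := bmeas_markov k bI.
have indU x : \1_U x = ((x \in A) || (x \in B))%:R :> R by rewrite indicE
  in_setU.
have indI x : \1_I x = ((x \in A) && (x \in B))%:R :> R by rewrite indicE
  in_setI.
have fU : flow pi k U (~` U) <= (4 * C + 2) * e.
  apply: le_trans qE; rewrite flowcE//.
  apply: (le_bRint pi1); [by bmeas|by bmeas|] => x.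
  have h1 : g x <= markov_op k \1_U x.
    apply: le_markov => // y; rewrite indU indicE.
    by case: (_ \in A); case: (_ \in B).
  have h2 : markov_op k \1_B x <= markov_op k \1_U x.
    apply: le_markov => // y; rewrite indU indicE.
    by case: (_ \in A); case: (_ \in B).
  by rewrite indU /q !indicE; exact: orb_defect_le.
have fI : flow pi k I (~` I) <= (4 * C + 2) * e.
  apply: le_trans qE; rewrite flowcE//.
  apply: (le_bRint pi1); [by bmeas|by bmeas|] => x.
  have h1 : g x + markov_op k \1_B x - 1 <= markov_op k \1_I x.
    rewrite -(markov_cst k 1 x) -markovD// -markovB//; [|by bmeas..].
    apply: le_markov => //; first by bmeas.
    by move=> y; rewrite indI !indicE andb_ge.
  by rewrite indI /q !indicE; exact: andb_defect_le.
have measE S : measurable S -> fine (pi S) = \int[pi]_x (\1_S x : R).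
  by move=> mS; rewrite bRint_indic.
apply: (two_step_arith (b := fine (pi B)) (u := fine (pi U)) (i := fine (pi
  I)) C0 kap0) => //.
- by rewrite a0.
- exact: fine_ge0.
- apply/andP; split.
    by rewrite fine_le ?fin_num_measure// le_measure ?inE//; exact: subsetUl.
  by rewrite -lee_fin fineK ?fin_num_measure// probability_le1.
- by rewrite fine_le ?fin_num_measure// le_measure ?inE//; exact: subIsetl.
- rewrite !measE// -!(bRintD pi1)//; apply: eq_Rintegral => x _.
  by rewrite indU indI !indicE orb_andb.
- by rewrite K0 ltW.
- exact: le_trans (iso_le _ mU) fU.
- exact: le_trans (iso_le _ mI) fI.
(* By invariance [pi(A)] is the integral of [g], which is [L^1]-close to [1_B]. *)
- rewrite -lerBlDl; apply: le_trans gB.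
  have -> : fine (pi A) = \int[pi]_x g x by rewrite (bRint_markov kpi bA) measE.
  rewrite measE// -(bRintB pi1)//; apply: (le_bRint pi1);
    [by bmeas|by bmeas|] => x.
  by rewrite distrC ler_norm.
(* The flow from [A] back into [A] is at most [i] plus the rounding error of [g]; the rest of
   [pi(A)] leaves. *)
- apply: le_trans hKA; rewrite -addrA lerD2l -opprD lerN2.
  apply: (@le_trans _ _ (\int[pi]_x (\1_I x + `|g x - \1_B x|))); last first.
    by rewrite (bRintD pi1)//; [rewrite -measE// lerD2l|by bmeas].
  apply: (le_bRint pi1); [by bmeas|by bmeas|] => x.
  by rewrite indI !indicE; exact: andb_overlap_le.
Qed.

End two_step.
End isoperimetry.

(** * Square-integrable functions *)

Section square_integrable.
Local Open Scope ring_scope.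
Context {d : measure_display} {T : measurableType d} {R : realType}.
Implicit Types f g : T -> R.

(** [L^2] for an arbitrary measure, needed under [pi] and under each [k x]; under [pi] it agrees
    with [Lfun pi 2%:E], see [Lfun2_sqint] and [sqint_Lfun2]. *)
Definition sqint (mu : {measure set T -> \bar R}) f :=
  measurable_fun [set: T] f /\
  mu.-integrable [set: T] (fun x => (f x ^+ 2)%:E).

Lemma sqintP (mu : {measure set T -> \bar R}) f :
  sqint mu f <->
  measurable_fun [set: T] f /\ (\int[mu]_x (f x ^+ 2)%:E < +oo)%E.
Proof.
split=> -[mf h]; split => //.
  move/integrableP : h => [_]; congr (_ < _)%E; apply: eq_integral => x _.
  by rewrite gee0_abs// lee_fin sqr_ge0.
apply/integrableP; split; first by apply/measurable_EFinP;
  exact: measurable_funX.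
rewrite (eq_integral (fun x => (f x ^+ 2)%:E))// => x _.
by rewrite gee0_abs// lee_fin sqr_ge0.
Qed.

Variable mu : {measure set T -> \bar R}.
Hypothesis mu1 : mu [set: T] = 1%E.

Lemma sqint_sqr f : sqint mu f -> mu.-integrable [set: T] (EFin \o (fun x
  => f x ^+ 2)).
Proof. by case. Qed.

Lemma sqint_RintE f : sqint mu f ->
  (\int[mu]_x (f x ^+ 2)%:E = (\int[mu]_x (f x ^+ 2))%R%:E)%E.
Proof.
by move=> [mf h]; rewrite /Rintegral fineK//; exact: integrable_fin_num h.
Qed.

Lemma bmeas_sqint f : bmeas f -> sqint mu f.
Proof.
move=> bf; split; first by case: bf.
by apply: (bmeas_integrable mu1 (f := fun x => f x ^+ 2)); bmeas.
Qed.

Lemma sqint_integrable f : sqint mu f -> mu.-integrable [set: T] (EFin \o f).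
Proof.
move=> [mf h]; apply: (@le_integrable _ _ _ mu _ measurableT _ (fun x => (1
  + f x ^+ 2)%:E)).
- exact/measurable_EFinP.
- move=> x _ /=; rewrite lee_fin [leRHS]ger0_norm ?addr_ge0 ?sqr_ge0//.
  rewrite -real_normK ?num_real//; set t := `|f x|.
  have : 0 <= (t - 1) ^+ 2 + t ^+ 2 + 1 by rewrite !addr_ge0 ?sqr_ge0.
  have : 0 <= (t - 2^-1) ^+ 2 by exact: sqr_ge0.
  by nra.
- rewrite (_ : (fun x => _) = fun x => (1%:E + (f x ^+ 2)%:E)%E)//.
  apply: integrableD => //.
  exact: (bmeas_integrable mu1 (bmeas_cst 1)).
Qed.

Lemma sqintZ c f : sqint mu f -> sqint mu (fun x => c * f x).
Proof.
move=> [mf h]; split; first exact: measurable_funM.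
rewrite (_ : (fun x => _) = fun x => ((c ^+ 2)%:E * (f x ^+ 2)%:E)%E).
  exact: integrableZl.
by apply/funext => x; rewrite -EFinM exprMn.
Qed.

Lemma sqintD f g : sqint mu f -> sqint mu g -> sqint mu (fun x => f x + g x).
Proof.
move=> [mf hf] [mg hg]; split; first exact: measurable_funD.
apply: (@le_integrable _ _ _ mu _ measurableT _
   (fun x => (2%:E * ((f x ^+ 2)%:E + (g x ^+ 2)%:E))%E)).
- by apply/measurable_EFinP; apply: measurable_funX; exact: measurable_funD.
- move=> x _ /=; rewrite lee_fin [leLHS]ger0_norm ?sqr_ge0//.
  rewrite [leRHS]ger0_norm; last by rewrite mulr_ge0// addr_ge0 ?sqr_ge0.
  rewrite -subr_ge0 (_ : _ - _ = (f x - g x) ^+ 2) ?sqr_ge0//; ring.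
- by apply: (integrableZl measurableT 2); exact: integrableD.
Qed.

Lemma sqintN f : sqint mu f -> sqint mu (fun x => - f x).
Proof. by move=> /(sqintZ (-1)); under eq_fun do rewrite mulN1r. Qed.

Lemma sqintB f g : sqint mu f -> sqint mu g -> sqint mu (fun x => f x - g x).
Proof. by move=> hf /sqintN hg; exact: sqintD. Qed.

Let iZ c f : mu.-integrable [set: T] (EFin \o f) ->
  mu.-integrable [set: T] (EFin \o (fun x => c * f x)).
Proof. by move=> h; exact: (integrableZl measurableT c h). Qed.

Let iD f g : mu.-integrable [set: T] (EFin \o f) ->
  mu.-integrable [set: T] (EFin \o g) ->
  mu.-integrable [set: T] (EFin \o (fun x => f x + g x)).
Proof. by move=> hf hg; exact: (integrableD measurableT hf hg). Qed.

Lemma Rint_sqr_ge f : sqint mu f ->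
  (\int[mu]_x f x) ^+ 2 <= \int[mu]_x (f x ^+ 2).
Proof.
move=> sf; set m := \int[mu]_x f x; rewrite -subr_ge0.
have if1 := sqint_integrable sf; have if2 := sqint_sqr sf.
have im (c : R) : mu.-integrable [set: T] (EFin \o (fun _ => c)).
  exact: (bmeas_integrable mu1 (bmeas_cst c)).
have -> : \int[mu]_x (f x ^+ 2) - m ^+ 2 = \int[mu]_x ((f x - m) ^+ 2).
  transitivity (\int[mu]_x (f x ^+ 2 + (- (2 * m) * f x + m ^+ 2))).
    rewrite RintegralD//; last by apply: iD; [exact: iZ|exact: im].
    rewrite RintegralD; [|by []|exact: iZ|exact: im].
    rewrite RintegralZl// (bRint_cst mu1) -/m; ring.
  by apply: eq_Rintegral => x _; ring.
by apply: Rintegral_ge0 => x _; exact: sqr_ge0.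
Qed.

(** The difference of the integrands is [eta^-1 * (eta * f - g)^2]. This replaces Minkowski's
    inequality and keeps square roots out. *)
Lemma Rint_sqr_young (eta : R) f g : 0 < eta -> sqint mu f -> sqint mu g ->
  \int[mu]_x ((f x + g x) ^+ 2) <=
  (1 + eta) * \int[mu]_x (f x ^+ 2) + (1 + eta^-1) * \int[mu]_x (g x ^+ 2).
Proof.
move=> eta0 sf sg; have sfg := sqintD sf sg.
have if2 := sqint_sqr sf; have ig2 := sqint_sqr sg.
rewrite -!RintegralZl// -RintegralD//; [|exact: iZ..].
apply: le_Rintegral => //.
- exact: sqint_sqr.
- by apply: iD; exact: iZ.
- move=> x _; rewrite -subr_ge0.
  rewrite (_ : _ - _ = eta^-1 * (eta * f x - g x) ^+ 2).
    by rewrite mulr_ge0 ?sqr_ge0// invr_ge0 ltW.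
  by field; rewrite gt_eqF.
Qed.

(** Truncate [f] where [|f| >= N]; the squared error is dominated by [f^2] and tends to zero
    pointwise. *)
Lemma sqint_dense f : sqint mu f -> forall e : R, 0 < e ->
  exists2 b, bmeas b & \int[mu]_x ((f x - b x) ^+ 2) <= e.
Proof.
move=> sf e e0; have [mf if2] := sf.
pose A (N : nat) := [set x | `|f x| < N%:R].
have mA N : measurable (A N).
  by apply: measurable_lt_cst; exact: measurableT_comp.
pose b N x := f x * \1_(A N) x.
have bb N : bmeas (b N).
  split; first by apply: measurable_funM => //; exact: measurable_indic.
  exists N%:R => x; rewrite /b indicE; have [xA|xA] := boolP (x \in A N).
    by rewrite mulr1; move: xA; rewrite inE => /ltW.
  by rewrite mulr0 normr0.
have mb N : measurable_fun [set: T] (fun x => ((f x - b N x) ^+ 2)%:E).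
  apply/measurable_EFinP; apply: measurable_funX; apply: measurable_funB => //.
  by case: (bb N).
have h1 : {ae mu, forall x, [set: T] x ->
    ((f x - b N x) ^+ 2)%:E @[N --> \oo] --> (cst 0%E : T -> \bar R) x}.
  apply: aeW => x _; apply: cvg_near_cst.
  exists (Num.bound `|f x|) => // N /= hN.
  rewrite /b indicE mem_set ?mulr1 ?subrr ?expr0n//=.
  by rewrite /A/= (lt_le_trans (archi_boundP _))// ler_nat.
have h2 : {ae mu, forall x n, [set: T] x ->
    (`|((f x - b n x) ^+ 2)%:E| <= (f x ^+ 2)%:E)%E}.
  apply: aeW => x N _; rewrite gee0_abs ?lee_fin ?sqr_ge0//.
  rewrite /b indicE; case: (_ \in _); last by rewrite mulr0 subr0.
  by rewrite mulr1 subrr expr0n sqr_ge0.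
have [_ _] := dominated_convergence measurableT mb (measurable_cst _) h1 if2 h2.
rewrite integral_cst// mul0e
  => /fine_cvgP[_] /cvgrPdist_lt/(_ e e0)[N _ /(_ N (leqnn N))].
rewrite /= sub0r normrN => hN; exists (b N) => //.
by apply: le_trans (ltW hN); exact: ler_norm.
Qed.

End square_integrable.

(** * The Markov operator on square-integrable functions *)

Section markov_square_integrable.
Local Open Scope ring_scope.
Context {d : measure_display} {T : measurableType d} {R : realType}.
Implicit Types (p k : R.-pker T ~> T) (f g : T -> R).

Lemma sqr_dist_triangle (u v w e : R) :
  (u - v) ^+ 2 <= e / 4 -> (w - v) ^+ 2 <= e / 4 -> (u - w) ^+ 2 <= e.
Proof.
have -> : u - w = (u - v) - (w - v) by ring.
by have := sqr_ge0 ((u - v) + (w - v)); move: (u - v) (w - v) => a c; nra.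
Qed.

Lemma measurable_markov k f : measurable_fun [set: T] f ->
  measurable_fun [set: T] (markov_op k f).
Proof.
move=> mf; apply: measurableT_comp => //.
under eq_fun do rewrite integralE.
have mk U : measurable U -> measurable_fun [set: T] (k ^~ U).
  by move=> mU; exact: measurable_kernel.
apply: emeasurable_funB; apply: measurable_fun_integral_kernel => //.
- by apply: measurable_funepos; exact/measurable_EFinP.
- by apply: measurable_funeneg; exact/measurable_EFinP.
Qed.

(** If a part is infinite, the extended integral is infinite ([+oo - oo] being [-oo]), and [fine]
    sends infinities to zero. *)
Lemma Rintegral_non_integrable (mu : {measure set T -> \bar R}) f :
  measurable_fun [set: T] f -> ~ mu.-integrable [set: T] (EFin \o f) ->
  \int[mu]_x f x = 0.
Proof.
move=> mf nif; have mf' : measurable_fun [set: T] (EFin \o f).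
  exact/measurable_EFinP.
rewrite /Rintegral integralE.
have [hn|hn] := eqVneq (\int[mu]_x (EFin \o f)^\- x)%E +oo%E.
  by rewrite hn addeNy.
have [hp|hp] := eqVneq (\int[mu]_x (EFin \o f)^\+ x)%E +oo%E.
  have : (0 <= \int[mu]_x (EFin \o f)^\- x)%E by exact: integral_ge0.
  by rewrite hp; move: hn; case: (\int[mu]_x (EFin \o f)^\- x)%E.
exfalso; apply: nif; apply/integrableP; split => //.
rewrite (eq_integral (fun x => ((EFin \o f)^\+ x + (EFin \o f)^\- x)%E));
  last first.
  by move=> x _; rewrite -[LHS]/((abse \o (EFin \o f)) x) fune_abse.
rewrite ge0_integralD//.
- by rewrite lte_add_pinfty// ltey.
- exact: measurable_funepos.
- exact: measurable_funeneg.
Qed.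

(** Where [f] is not integrable under [k x], neither is [c * f], and both sides take the default
    value zero. Homogeneity is thus exact at every point and survives iteration. *)
Lemma markov_opZ k c f x : c != 0 -> measurable_fun [set: T] f ->
  markov_op k (fun y => c * f y) x = c * markov_op k f x.
Proof.
move=> c0 mf.
have [iF|niF] := pselect ((k x).-integrable [set: T] (EFin \o f)).
  exact: RintegralZl.
rewrite /markov_op (Rintegral_non_integrable mf niF) mulr0.
apply: Rintegral_non_integrable; first exact: measurable_funM.
move=> icf; apply: niF.
rewrite (_ : _ \o _ = fun y => (c^-1%:E * (c * f y)%:E)%E).
  exact: (integrableZl measurableT _ icf).
by apply/funext => y; rewrite /= -EFinM mulKf.
Qed.

Lemma measurable_iter_markov p m f : measurable_fun [set: T] f ->
  measurable_fun [set: T] (iter m (markov_op p) f).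
Proof. by move=> mf; elim: m => //= m; exact: measurable_markov. Qed.

Lemma iter_markovZ p m c f : c != 0 -> measurable_fun [set: T] f ->
  iter m (markov_op p) (fun y => c * f y) =
  (fun y => c * iter m (markov_op p) f y).
Proof.
move=> c0 mf; elim: m => //= m ->; apply/funext => x.
by rewrite markov_opZ//; exact: measurable_iter_markov.
Qed.

Variables (pi : probability T R) (k : R.-pker T ~> T).
Hypothesis kpi : invariant_measure k pi.

Let pi1 : pi [set: T] = 1%E. Proof. exact: probability_setT. Qed.
Let k1 x : k x [set: T] = 1%E. Proof. exact: prob_kernel. Qed.

(** By invariance the [pi]-integral of [\int f^2 dk_x] is that of [f^2], hence finite, so the inner
    integral is finite almost everywhere. *)
Lemma ae_sqint f : sqint pi f -> {ae pi, forall x, sqint (k x) f}.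
Proof.
move=> /sqintP[mf h].
have mf2 : measurable_fun [set: T] (fun y => (f y ^+ 2)%:E).
  by apply/measurable_EFinP; exact: measurable_funX.
have ii : pi.-integrable [set: T] (fun x => \int[k x]_y (f y ^+ 2)%:E)%E.
  apply/integrableP; split.
    apply: measurable_fun_integral_kernel => //.
    - by move=> U mU; exact: measurable_kernel.
    - by move=> y; rewrite lee_fin sqr_ge0.
  rewrite (eq_integral (fun x => \int[k x]_y (f y ^+ 2)%:E)%E); last first.
    move=> x _; rewrite gee0_abs//; apply: integral_ge0 => y _.
    by rewrite lee_fin sqr_ge0.
  rewrite (ge0_integral_invariant kpi)//.
  by move=> x; rewrite lee_fin sqr_ge0.
have := integrable_ae measurableT ii; apply: filterS => x /(_ I) hx.
by apply/sqintP; split => //; rewrite ltey_eq hx.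
Qed.

(** Jensen under [k x] at almost every [x], then invariance. It is stated for differences because
    [P] is additive on [L^2] only almost everywhere, and in [\bar R] because [sqint_markov] derives
    finiteness from it. *)
Lemma markov_contract f g : sqint pi f -> sqint pi g ->
  (\int[pi]_x ((markov_op k f x - markov_op k g x) ^+ 2)%:E <=
   \int[pi]_x ((f x - g x) ^+ 2)%:E)%E.
Proof.
move=> sf sg; have mf := sf.1; have mg := sg.1.
have msq : measurable_fun [set: T] (fun y => ((f y - g y) ^+ 2)%:E).
  by apply/measurable_EFinP; apply: measurable_funX; exact: measurable_funB.
have sq0 (h : T -> R) y : (0 <= (h y ^+ 2)%:E)%E by rewrite lee_fin sqr_ge0.
rewrite -[X in (_ <= X)%E](ge0_integral_invariant kpi)//; last by move=> y;
  rewrite lee_fin sqr_ge0.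
apply: ae_ge0_le_integral => //.
- by move=> x _; rewrite lee_fin sqr_ge0.
- by apply/measurable_EFinP; apply: measurable_funX; apply: measurable_funB;
    exact: measurable_markov.
- by move=> x _; apply: integral_ge0 => y _; rewrite lee_fin sqr_ge0.
- apply: measurable_fun_integral_kernel => //.
  + by move=> U mU; exact: measurable_kernel.
  + by move=> y; rewrite lee_fin sqr_ge0.
apply: filterS2 (ae_sqint sf) (ae_sqint sg) => x sfx sgx _.
have sfg := sqintB sfx sgx.
rewrite (sqint_RintE sfg) lee_fin /markov_op -RintegralB//; last 2 first.
- exact: (sqint_integrable (k1 x)).
- exact: (sqint_integrable (k1 x)).
exact: (Rint_sqr_ge (k1 x)).
Qed.

Lemma sqint_markov f : sqint pi f -> sqint pi (markov_op k f).
Proof.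
move=> sf; apply/sqintP; split; first exact: measurable_markov sf.1.
have s0 : sqint pi (fun _ : T => 0 : R) by apply: (bmeas_sqint pi1);
  exact: bmeas_cst.
have h := markov_contract sf s0.
apply: le_lt_trans (le_lt_trans h _).
  rewrite le_eqVlt; apply/orP; left; apply/eqP.
  by apply: eq_integral => x _; rewrite markov_cst subr0.
by under eq_integral do rewrite subr0; case/sqintP: sf.
Qed.

Lemma le_Rint_markovB f g : sqint pi f -> sqint pi g ->
  \int[pi]_x ((markov_op k f x - markov_op k g x) ^+ 2) <=
  \int[pi]_x ((f x - g x) ^+ 2).
Proof.
move=> sf sg; rewrite -lee_fin -!sqint_RintE; first exact: markov_contract.
- by apply: sqintB.
- by apply: sqintB; exact: sqint_markov.
Qed.

(** Known for bounded functions; both sides are [L^2]-continuous, so a bounded approximation within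
    [e / 4] suffices. *)
Lemma Rint_markov f : sqint pi f ->
  \int[pi]_x markov_op k f x = \int[pi]_x f x.
Proof.
move=> sf; have sPf := sqint_markov sf.
apply/eqP; rewrite -subr_eq0 -sqrf_eq0; apply/eqP/le_anti;
  rewrite sqr_ge0 andbT.
apply/ler_addgt0Pr => e e0; rewrite add0r.
have e40 : 0 < e / 4 by rewrite divr_gt0.
have [b bb fb] := sqint_dense sf e40.
have sb := bmeas_sqint pi1 bb.
have sPb := sqint_markov sb.
have h1 : (\int[pi]_x markov_op k f x - \int[pi]_x b x) ^+ 2 <= e / 4.
  rewrite -(bRint_markov kpi bb) -RintegralB//; [|exact: sqint_integrable..].
  apply: (le_trans (Rint_sqr_ge pi1 (sqintB sPf sPb))).
  exact: (le_trans (le_Rint_markovB sf sb)).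
have h2 : (\int[pi]_x f x - \int[pi]_x b x) ^+ 2 <= e / 4.
  rewrite -RintegralB//; [|exact: sqint_integrable..].
  exact: (le_trans (Rint_sqr_ge pi1 (sqintB sf sb))).
exact: sqr_dist_triangle h1 h2.
Qed.

End markov_square_integrable.

(** Two uses of Young's inequality with [eta = delta / 8] cost at most half of the gap [delta]. *)
Lemma gap_rate_le {R : realType} (delta : R) : (0 < delta -> delta <= 1 ->
  (1 + delta / 8) ^+ 2 * (1 - delta) <= 1 - delta / 2)%R.
Proof. by move=> d0 d1; nra. Qed.

(** * Iterates of [P] and passage from bounded to square-integrable functions *)

Section iterated.
Local Open Scope ring_scope.
Context {d : measure_display} {T : measurableType d} {R : realType}.
Variables (pi : probability T R) (p : R.-pker T ~> T).
Hypothesis ppi : invariant_measure p pi.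
Implicit Types f g : T -> R.
Let P := markov_op p.
Let pi1 : pi [set: T] = 1%E. Proof. exact: probability_setT. Qed.

Lemma sqint_iter m f : sqint pi f -> sqint pi (iter m P f).
Proof. by move=> sf; elim: m => //= m; exact: sqint_markov. Qed.

Lemma Rint_iter m f : sqint pi f -> \int[pi]_x iter m P f x = \int[pi]_x f x.
Proof.
move=> sf; elim: m => //= m <-; apply: Rint_markov => //; exact: sqint_iter.
Qed.

Lemma le_Rint_iterB m f g : sqint pi f -> sqint pi g ->
  \int[pi]_x ((iter m P f x - iter m P g x) ^+ 2) <=
  \int[pi]_x ((f x - g x) ^+ 2).
Proof.
move=> sf sg; elim: m => //= m; apply: le_trans.
by apply: le_Rint_markovB => //; exact: sqint_iter.
Qed.

Lemma le_Rint_iter m f : sqint pi f ->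
  \int[pi]_x (iter m P f x ^+ 2) <= \int[pi]_x (f x ^+ 2).
Proof.
move=> sf; have s0 : sqint pi (fun _ : T => 0 : R).
  by apply: (bmeas_sqint pi1); exact: bmeas_cst.
have E0 : iter m P (fun _ => 0) = fun _ => 0.
  by elim: m => //= m ->; apply/funext => x; rewrite /P markov_cst.
have -> : \int[pi]_x (iter m P f x ^+ 2) =
    \int[pi]_x ((iter m P f x - iter m P (fun _ => 0) x) ^+ 2).
  by apply: eq_Rintegral => x _; rewrite E0 subr0.
have -> : \int[pi]_x (f x ^+ 2) = \int[pi]_x ((f x - 0) ^+ 2).
  by apply: eq_Rintegral => x _; rewrite subr0.
exact: le_Rint_iterB.
Qed.

(** A bounded approximant [b] of a centred [f] need not be centred, which is why the hypothesis
    carries the squared mean of [b]; that mean is controlled by the distance from [f] to [b]. *)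
Lemma bounded_gap_extend m (delta : R) : 0 < delta <= 1 ->
  (forall b, bmeas b -> \int[pi]_x (iter m P b x ^+ 2) <=
     (1 - delta) * \int[pi]_x (b x ^+ 2) + delta * (\int[pi]_x b x) ^+ 2) ->
  forall f, sqint pi f -> \int[pi]_x f x = 0 ->
  \int[pi]_x (iter m P f x ^+ 2) <= (1 - delta / 2) * \int[pi]_x (f x ^+ 2).
Proof.
move=> /andP[d0 d1] hb f sf f0.
pose eta := delta / 8.
have eta0 : 0 < eta by rewrite divr_gt0.
pose c := 1 + eta^-1.
have c0 : 0 < c by rewrite addr_gt0 ?invr_gt0.
(* [M] is the total coefficient of the approximation error [e1], so [e1 <= e / M] leaves an error
   [e]. *)
pose M := (1 + eta) * ((1 - delta) * c + delta) + c.
have eta1 : 0 <= 1 + eta by rewrite addr_ge0// ltW.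
have d1' : 0 <= 1 - delta by rewrite subr_ge0.
have M0 : 0 < M.
  apply: ltr_wpDl => //; apply: mulr_ge0 => //.
  by apply: addr_ge0; [apply: mulr_ge0 => //; exact: ltW|exact: ltW].
apply/ler_addgt0Pr => e e0.
have eM0 : 0 < e / M by rewrite divr_gt0.
have [b bb fb] := sqint_dense sf eM0.
have sb := bmeas_sqint pi1 bb.
have sPb := sqint_iter m sb; have sPf := sqint_iter m sf.
set N := \int[pi]_x (f x ^+ 2).
set e1 := \int[pi]_x ((f x - b x) ^+ 2) in fb.
have h1 : \int[pi]_x (iter m P f x ^+ 2) <=
    (1 + eta) * \int[pi]_x (iter m P b x ^+ 2) + c * e1.
  have := Rint_sqr_young eta0 sPb (sqintB sPf sPb).
  under eq_Rintegral do rewrite subrKC.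
  by move=> /le_trans; apply; rewrite lerD2l; apply: ler_wpM2l;
    [exact: ltW|exact: le_Rint_iterB].
have h2 : \int[pi]_x (b x ^+ 2) <= (1 + eta) * N + c * e1.
  have := Rint_sqr_young eta0 sf (sqintB sb sf).
  under eq_Rintegral do rewrite subrKC.
  move=> /le_trans; apply; rewrite lerD2l; apply: ler_wpM2l; first exact: ltW.
  rewrite le_eqVlt; apply/orP; left; apply/eqP; apply: eq_Rintegral => x _.
  by rewrite -sqrrN opprB.
have h3 : (\int[pi]_x b x) ^+ 2 <= e1.
  have -> : \int[pi]_x b x = - (\int[pi]_x (f x - b x)).
    rewrite RintegralB; [|by []|exact: sqint_integrable..].
    by rewrite f0 sub0r opprK.
  by rewrite sqrrN; exact: (Rint_sqr_ge pi1 (sqintB sf sb)).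
have N0 : 0 <= N by apply: Rintegral_ge0 => x _; exact: sqr_ge0.
have h4 := hb b bb.
apply: (le_trans h1).
apply: (@le_trans _ _ ((1 + eta) * ((1 - delta) * ((1 + eta) * N + c * e1)
  + delta * e1) + c * e1)).
  rewrite lerD2r ler_wpM2l//; apply: (le_trans h4).
  by apply: lerD; apply: ler_wpM2l => //; exact: ltW.
have -> : (1 + eta) * ((1 - delta) * ((1 + eta) * N + c * e1) + delta * e1)
  + c * e1
  = (1 + eta) ^+ 2 * (1 - delta) * N + M * e1 by rewrite /M; ring.
apply: lerD; last by rewrite mulrC -ler_pdivlMr.
by apply: ler_wpM2r => //; rewrite /eta; exact: gap_rate_le.
Qed.

End iterated.

(** * The spectral gap *)

Section spectral_gap.
Local Open Scope ring_scope.
Context {d : measure_display} {T : measurableType d} {R : realType}.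
Variables (pi : probability T R) (p : R.-pker T ~> T).
Hypothesis ppi : invariant_measure p pi.
Hypothesis nontriv : exists A, nontrivial_set pi A.
Implicit Types f g : T -> R.
Let P := markov_op p.
Let pi1 : pi [set: T] = 1%E. Proof. exact: probability_setT. Qed.

(** [c] bounds the squared operator norm of [P^m] on mean-zero functions. *)
Definition contraction m (c : R) := forall f, sqint pi f ->
  \int[pi]_x f x = 0 ->
  \int[pi]_x (iter m P f x ^+ 2) <= c * \int[pi]_x (f x ^+ 2).

Lemma contraction1 m : contraction m 1.
Proof. by move=> f sf _; rewrite mul1r; exact: le_Rint_iter. Qed.

Lemma contractionD a b (c c' : R) : 0 <= c ->
  contraction a c -> contraction b c' -> contraction (a + b) (c * c').
Proof.
move=> c0 ha hb f sf f0.
have -> : iter (a + b) P f = iter a P (iter b P f) by rewrite iterD.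
apply: le_trans (ha _ (sqint_iter ppi b sf) _) _.
  by rewrite -f0; exact: Rint_iter.
by rewrite -mulrA; apply: ler_wpM2l => //; exact: hb.
Qed.

Lemma contractionM m q (c : R) : 0 <= c ->
  contraction m c -> contraction (m * q) (c ^+ q).
Proof.
move=> c0 hm; elim: q => [|q ih]; first by rewrite muln0 expr0;
  exact: contraction1.
by rewrite mulnS exprS; exact: contractionD.
Qed.

Lemma Lnorm2E f : sqint pi f ->
  ('N[pi]_2%:E[EFin \o f] = ((\int[pi]_x (f x ^+ 2)) `^ 2^-1)%:E)%E.
Proof.
move=> sf; rewrite unlock -poweR_EFin -(sqint_RintE sf).
congr (poweR _ _); apply: eq_integral => x _.
by rewrite /= powR_mulrn// real_normK ?num_real.
Qed.

Lemma Lfun2_sqint f : f \in Lfun pi 2%:E -> sqint pi f.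
Proof.
move=> /andP[]; rewrite !inE => mf; rewrite /finite_norm /= unlock.
have two0 : 2^-1 != 0 :> R by rewrite invr_neq0// pnatr_eq0.
move=> /(lty_poweRy two0) h.
apply/sqintP; split => //; move: h.
congr (_ < _)%E; apply: eq_integral => x _.
by rewrite /= powR_mulrn// real_normK ?num_real.
Qed.

Lemma sqint_Lfun2 f : sqint pi f -> f \in Lfun pi 2%:E.
Proof.
move=> sf; apply/andP; split; rewrite !inE; first by case: sf.
by rewrite /finite_norm /= Lnorm2E// ltry.
Qed.

Definition gap_seq (m : nat) : \bar R :=
  ereal_sup [set poweR ('N[pi]_2%:E[EFin \o iter m P f]) m%:R^-1
            | f in L2_01 pi].

(** The [L^2] norm brings the exponent [1/2] and the gap sequence [1/m], hence the power [2 * m]. *)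
Lemma powR_root_le (x r : R) m : (0 < m)%N -> 0 <= x -> 0 <= r ->
  (x `^ 2^-1 `^ m%:R^-1 <= r) = (x <= r ^+ (2 * m)).
Proof.
move=> m0 x0 r0; have m0' : m%:R != 0 :> R by rewrite pnatr_eq0 -lt0n.
have e : 2^-1 * m%:R^-1 = (2 * m)%:R^-1 :> R by rewrite natrM invfM.
have n0 : 0 < (2 * m)%:R :> R by rewrite ltr0n muln_gt0.
rewrite -powRrM e; apply/idP/idP => h.
  rewrite -powR_mulrn//.
  have -> : x = x `^ (2 * m)%:R^-1 `^ (2 * m)%:R.
    by rewrite -powRrM mulVf ?gt_eqF// powRr1.
  by apply: ge0_ler_powR => //; rewrite ?nnegrE ?powR_ge0// ltW.
have -> : r = (r ^+ (2 * m)) `^ (2 * m)%:R^-1.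
  by rewrite -powR_mulrn// -powRrM mulfV ?gt_eqF// powRr1.
by apply: ge0_ler_powR => //; rewrite ?nnegrE ?exprn_ge0// invr_ge0 ltW.
Qed.

Lemma gap_seq_le m (r : R) : (0 < m)%N -> 0 <= r ->
  (gap_seq m <= r%:E)%E <-> contraction m (r ^+ (2 * m)).
Proof.
move=> m0 r0; split=> [h f sf f0|h].
  have N0 : 0 <= \int[pi]_x (f x ^+ 2) by apply: Rintegral_ge0 => x _;
    exact: sqr_ge0.
  (* A function of norm zero cannot be normalized; for it both sides vanish by contraction. *)
  have [Nf|Nf] := eqVneq (\int[pi]_x (f x ^+ 2)) 0.
    by rewrite Nf mulr0 -Nf; exact: le_Rint_iter.
  have {}N0 : 0 < \int[pi]_x (f x ^+ 2) by rewrite lt_neqAle eq_sym Nf.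
  pose s := Num.sqrt (\int[pi]_x (f x ^+ 2)).
  have s0 : 0 < s by rewrite sqrtr_gt0.
  have s2 : s ^+ 2 = \int[pi]_x (f x ^+ 2) by rewrite sqr_sqrtr// ltW.
  pose g x := s^-1 * f x.
  have sg : sqint pi g by exact: sqintZ.
  have sqZ (c : R) u : sqint pi u ->
      \int[pi]_x ((c * u x) ^+ 2) = c ^+ 2 * \int[pi]_x (u x ^+ 2).
    move=> su; rewrite -RintegralZl//; last exact: sqint_sqr.
    by apply: eq_Rintegral => x _; rewrite exprMn.
  have gL : L2_01 pi g.
    split; first exact: sqint_Lfun2.
    - rewrite RintegralZl//; last exact: (sqint_integrable pi1 sf).
      by rewrite f0 mulr0.
    - by rewrite sqZ// exprVn s2 mulVf.
  have : (poweR ('N[pi]_2%:E[EFin \o iter m P g]) m%:R^-1 <= r%:E)%E.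
    by apply: le_trans h; apply: ereal_sup_ubound; exists g.
  have sPf := sqint_iter ppi m sf.
  rewrite Lnorm2E; last exact: sqint_iter.
  rewrite poweR_EFin lee_fin powR_root_le//; last first.
    by apply: Rintegral_ge0 => x _; exact: sqr_ge0.
  rewrite /g iter_markovZ; [|by rewrite invr_neq0// gt_eqF|exact: sf.1].
  by rewrite sqZ// exprVn s2 mulrC ler_pdivrMr.
apply: ge_ereal_sup => _ [f [Lf f0 f1] <-].
have sf := Lfun2_sqint Lf; have sPf := sqint_iter ppi m sf.
rewrite Lnorm2E// poweR_EFin lee_fin powR_root_le//; last first.
  by apply: Rintegral_ge0 => x _; exact: sqr_ge0.
by apply: le_trans (h f sf f0) _; rewrite f1 mulr1.
Qed.

(** A supremum over an empty [L2_01] would be [-oo]; a normalized indicator shows that it is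
    inhabited. *)
Lemma gap_seq_ge0 m : (0 <= gap_seq m)%E.
Proof.
have [A ntA] := nontriv; have [f [bf f0 f1 _]] := normalized_indicator ntA.
apply: (@le_trans _ _ (poweR ('N[pi]_2%:E[EFin \o iter m P f]) m%:R^-1)).
  exact: poweR_ge0.
apply: ereal_sup_ubound; exists f => //; split => //.
by apply: sqint_Lfun2; exact: bmeas_sqint.
Qed.

Lemma gap_seq_le1 m : (0 < m)%N -> (gap_seq m <= 1)%E.
Proof.
by move=> m0; apply/(gap_seq_le m0 ler01); rewrite expr1n; exact: contraction1.
Qed.

Lemma gap_seq_fin m : (0 < m)%N -> gap_seq m \is a fin_num.
Proof.
move=> m0; rewrite ge0_fin_numE ?gap_seq_ge0//.
by apply: le_lt_trans (gap_seq_le1 m0) _; rewrite ltry.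
Qed.

(** For a total time [m * q + s] with remainder [s <= m], the lost steps cost a factor [r^m], which
    the ratio [r / r'] makes up for once the time is large. *)
Lemma submultiplicative_rate m q s (r r' : R) : 0 < r <= 1 -> r < r' ->
  (r / r') ^+ (m * q + s) <= r ^+ m -> (s <= m)%N ->
  (r ^+ (2 * m)) ^+ q <= r' ^+ (2 * (m * q + s)).
Proof.
move=> /andP[r0 r1] rr' h sm; have r'0 : 0 < r' := lt_trans r0 rr'.
have e : (r ^+ (2 * m)) ^+ q = (r ^+ (m * q)) ^+ 2.
  by rewrite -!exprM; congr (_ ^+ _); ring.
have -> : r' ^+ (2 * (m * q + s)) = (r' ^+ (m * q + s)) ^+ 2.
  by rewrite -exprM mulnC.
rewrite e ler_pXn2r// ?nnegrE ?exprn_ge0//; [|exact: ltW..].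
rewrite -(ler_pM2r (exprn_gt0 m r0)) -exprD.
apply: (@le_trans _ _ (r ^+ (m * q + s))).
  by apply: ler_wiXn2l => //; [exact: ltW|rewrite leq_add2l].
by rewrite expr_div_n ler_pdivrMr ?exprn_gt0// mulrC in h.
Qed.

(** Fekete's lemma in multiplicative form: operator norms are submultiplicative, so their roots
    converge to their infimum. *)
Lemma gap_seq_cvg : exists l : R,
  gap_seq @ \oo --> l%:E /\ forall m, (0 < m)%N -> (l%:E <= gap_seq m)%E.
Proof.
pose v m := fine (gap_seq m).
have vE m : (0 < m)%N -> gap_seq m = (v m)%:E.
  by move=> m0; rewrite fineK// gap_seq_fin.
have v0 m : 0 <= v m by apply: fine_ge0; exact: gap_seq_ge0.
have v1 m : (0 < m)%N -> v m <= 1.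
  by move=> m0; rewrite -lee_fin -vE// gap_seq_le1.
pose S := [set v m | m in [set m | (0 < m)%N]].
have lbS : has_lbound S by exists 0 => _ [m _ <-].
have S0 : S !=set0 by exists (v 1%N); exists 1%N.
pose l := inf S; exists l.
have lv m : (0 < m)%N -> l <= v m by move=> m0; apply: ge_inf => //; exists m.
have l0 : 0 <= l by apply: lb_le_inf => // _ [m _ <-].
split; last by move=> m m0; rewrite vE// lee_fin lv.
apply/fine_cvgP; split; first by exists 1%N => // m /= m0; exact: gap_seq_fin.
apply/cvgrPdist_le => e e0.
have e20 : 0 < e / 2 by rewrite divr_gt0.
have [_ [m0 m0gt <-]] := inf_adherent e20 (conj S0 lbS).
rewrite -/l => vm0; pose r := l + e / 2.
have r0 : 0 < r by rewrite ltr_wpDl.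
have rr' : r < l + e by rewrite ltrD2l ltr_pdivrMr// mulrDr mulr1 ltrDl.
have dist m : (0 < m)%N -> v m <= l + e -> `|l - v m| <= e.
  by move=> mgt hv; rewrite distrC ger0_norm ?subr_ge0 ?lv// lerBlDl.
(* If [r > 1], the bound [v m <= 1] is already enough; otherwise divide [m] by [m0] with
   remainder. *)
have [r1|r1] := ltP 1 r.
  exists 1%N => // m /= mgt; apply: dist => //.
  exact: le_trans (v1 _ mgt) (ltW (lt_trans r1 rr')).
have r'0 := lt_trans r0 rr'.
have c0 : contraction m0 (r ^+ (2 * m0)).
  by apply/gap_seq_le => //; rewrite ?ltW// vE// lee_fin ltW.
have z1 : `|r / (l + e)| < 1.
  by rewrite ger0_norm ?divr_ge0 ?ltW// ltr_pdivrMr// mul1r.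
have := cvg_expr z1 => /cvgrPdist_lt/(_ _ (exprn_gt0 m0 r0))[M _ hM].
exists (maxn M 1) => // m /=; rewrite geq_max => /andP[Mm mgt].
apply: dist => //; rewrite -lee_fin -vE//.
apply/(gap_seq_le mgt (ltW r'0)).
have hm : (r / (l + e)) ^+ m <= r ^+ m0.
  have := hM m Mm; rewrite /= sub0r normrN => /ltW; apply: le_trans.
  exact: ler_norm.
move: hm; rewrite (divn_eq m m0) mulnC => hm.
move=> f sf f0; have := contractionD (exprn_ge0 _ (exprn_ge0 _ (ltW r0)))
  (contractionM (m %/ m0) (exprn_ge0 _ (ltW r0)) c0) (@contraction1 (m %% m0))
    sf f0.
move=> /le_trans; apply; rewrite mulr1; apply: ler_wpM2r.
  by apply: Rintegral_ge0 => x _; exact: sqr_ge0.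
apply: submultiplicative_rate => //; first by rewrite r0.
by apply: ltnW; rewrite ltn_mod.
Qed.

(** The limit is an infimum, so a single strict contraction bounds it by [c^(1/(2n)) < 1]. *)
Lemma contraction_spectral_gap n (c : R) : (0 < n)%N -> 0 <= c < 1 ->
  contraction n c -> L2_spectral_gap p pi.
Proof.
move=> n0 /andP[c0 c1] hc; have [l [ul lu]] := gap_seq_cvg.
split; first by apply/cvg_ex; exists l%:E.
rewrite -[X in limn X]/gap_seq (cvg_lim _ ul)//.
have n0' : 0 < (2 * n)%:R :> R by rewrite ltr0n muln_gt0.
apply: le_lt_trans (lu n n0) _.
apply: (@le_lt_trans _ _ (c `^ (2 * n)%:R^-1)%:E).
  apply/(gap_seq_le n0 (powR_ge0 _ _)).
  by rewrite -powR_mulrn ?powR_ge0// -powRrM mulVf ?gt_eqF// powRr1.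
rewrite lte_fin; apply: (@lt_le_trans _ _ (1 `^ (2 * n)%:R^-1));
  last by rewrite powR1.
by apply: gt0_ltr_powR; rewrite ?invr_gt0 ?nnegrE.
Qed.

(** A limit below one makes large powers strict contractions; a multiple of [N] is chosen so that
    the power is an iterate of [P^N]. *)
Lemma spectral_gap_contraction N : L2_spectral_gap p pi -> (0 < N)%N ->
  exists q (c : R), [/\ (0 < q)%N, 0 <= c < 1 & contraction (N * q) c].
Proof.
move=> [_ lt1] N0; have [l [ul _]] := gap_seq_cvg.
rewrite -[X in limn X]/gap_seq (cvg_lim _ ul)// lte_fin in lt1.
have /fine_cvgP[_ /cvgr_lt /(_ 1 lt1)[M _ hM]] := ul.
exists (maxn M 1); set q := maxn M 1.
have q0 : (0 < q)%N by rewrite leq_max orbT.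
have Nq0 : (0 < N * q)%N by rewrite muln_gt0 N0.
have MNq : (M <= N * q)%N.
  by apply: (leq_trans (leq_maxl M 1)); exact: leq_pmull.
have := hM _ MNq; rewrite /=.
set r := fine _ => r1.
have r0 : 0 <= r by apply: fine_ge0; exact: gap_seq_ge0.
exists (r ^+ (2 * (N * q))); split => //.
  by rewrite exprn_ge0//= exprn_ilt1// muln_eq0/= -lt0n.
by apply/gap_seq_le => //; rewrite fineK// gap_seq_fin.
Qed.

End spectral_gap.

(** * The equivalences *)

(** For mass at most one half, [1 - a >= 1/2] trades the normalization [a (1 - a)] for the
    normalization [a] of Cheeger's inequality. *)
Lemma half_iso_le {R : realType} (m h a : R) :
  (m <= h -> 0 <= h -> 0 <= a -> a <= 2^-1 -> m / 2 * a <= h * (a * (1 - a)))%R.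
Proof.
move=> mh h0 a0 a2; apply: (@le_trans _ _ (h / 2 * a)%R).
  by apply: ler_wpM2r => //; lra.
rewrite -subr_ge0 (_ : (_ - _ = h * a * (2^-1 - a))%R); last by field.
by rewrite !mulr_ge0// subr_ge0.
Qed.

Section equivalences.
Local Open Scope ring_scope.
Context {d : measure_display} {T : measurableType d} {R : realType}.
Variables (pi : probability T R) (p : R.-pker T ~> T) (n : nat).
Hypothesis n_gt0 : (0 < n)%N.
Hypothesis ppi : invariant_measure p pi.
Hypothesis nontriv : exists A, nontrivial_set pi A.
Implicit Types f g : T -> R.
Let P := markov_op p.
Let pi1 : pi [set: T] = 1%E. Proof. exact: probability_setT. Qed.

Definition iso_ratio m (A : set T) : R :=
  flow pi (kiter p m) A (~` A) / (fine (pi A) * (1 - fine (pi A))).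

Lemma iso_inf_gt0P m : (0 < iso_inf p pi m)%E <->
  exists2 h : R, 0 < h & forall A, nontrivial_set pi A -> h <= iso_ratio m A.
Proof.
split=> [h0|[h h0 hA]]; last first.
  apply: (@lt_le_trans _ _ h%:E); first by rewrite lte_fin.
  apply: le_ereal_inf_tmp => _ [A ntA <-].
  by rewrite isoperimetric_ratioE// lee_fin; exact: hA.
have lb A : nontrivial_set pi A -> (iso_inf p pi m <= (iso_ratio m A)%:E)%E.
  move=> ntA; rewrite /iso_ratio -isoperimetric_ratioE//.
  by apply: ereal_inf_lbound; exists A.
have [A0 ntA0] := nontriv.
(* A nontrivial set keeps the infimum away from [+oo], so it is itself the real witness. *)
have finf : iso_inf p pi m \is a fin_num.
  rewrite ge0_fin_numE ?ltW//.
  by apply: le_lt_trans (lb _ ntA0) _; rewrite ltry.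
exists (fine (iso_inf p pi m)); first by rewrite -lte_fin fineK.
by move=> A ntA; rewrite -lee_fin fineK// lb.
Qed.

Lemma iso_sup_lt2P m : (iso_sup p pi m < 2%:E)%E <->
  exists2 K : R, K < 2 & forall A, nontrivial_set pi A -> iso_ratio m A <= K.
Proof.
split=> [h2|[K K2 hA]]; last first.
  apply: (@le_lt_trans _ _ K%:E); last by rewrite lte_fin.
  apply: ge_ereal_sup => _ [A ntA <-].
  by rewrite isoperimetric_ratioE// lee_fin; exact: hA.
have ub A : nontrivial_set pi A -> ((iso_ratio m A)%:E <= iso_sup p pi m)%E.
  move=> ntA; rewrite /iso_ratio -isoperimetric_ratioE//.
  by apply: ereal_sup_ubound; exists A.
have [A0 ntA0] := nontriv.
have fsup : iso_sup p pi m \is a fin_num.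
  rewrite fin_numElt; apply/andP; split.
    by apply: lt_le_trans (ub _ ntA0); rewrite ltNyr.
  by apply: lt_trans h2 _; rewrite ltry.
exists (fine (iso_sup p pi m)); first by rewrite -lte_fin fineK.
by move=> A ntA; rewrite -lee_fin fineK// ub.
Qed.

Lemma iso_inf_le_sup m : (iso_inf p pi m <= iso_sup p pi m)%E.
Proof.
have [A ntA] := nontriv.
apply: (@le_trans _ _ (isoperimetric_ratio p pi m A)).
  by apply: ereal_inf_lbound; exists A.
by apply: ereal_sup_ubound; exists A.
Qed.

Lemma normalized_indicator_iter A : nontrivial_set pi A ->
  exists f : T -> R, [/\ bmeas f, \int[pi]_x f x = 0,
    \int[pi]_x (f x ^+ 2) = 1 &
    forall m, \int[pi]_x (f x * iter m P f x) = 1 - iso_ratio m A].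
Proof.
move=> ntA; have [f [bf f0 f1 fk]] := normalized_indicator ntA.
exists f; split => // m; rewrite /iso_ratio -fk; last exact: invariant_kiter.
by rewrite markov_kiter.
Qed.

Lemma markov_kiter_double f : bmeas f -> markov_op (kiter p (2 * n)) f =
  markov_op (kiter p n) (markov_op (kiter p n) f).
Proof.
move=> bf; rewrite !markov_kiter//; last exact: bmeas_iter_markov.
by rewrite mul2n -addnn iterD.
Qed.

Lemma iter_defect m (sigma : R) f : sigma ^+ 2 = 1 -> bmeas f ->
  \int[pi]_x (f x ^+ 2) = 1 ->
  \int[pi]_x ((iter m P f x - sigma * f x) ^+ 2) <=
  2 - 2 * sigma * \int[pi]_x (f x * iter m P f x).
Proof.
move=> s2 bf f1; have bPf : bmeas (iter m P f) by exact: bmeas_iter_markov.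
have : \int[pi]_x (iter m P f x ^+ 2) <= 1.
  by rewrite -f1; apply: le_Rint_iter => //; exact: bmeas_sqint.
have -> : \int[pi]_x ((iter m P f x - sigma * f x) ^+ 2) =
  \int[pi]_x (iter m P f x ^+ 2) - 2 * sigma * \int[pi]_x (f x * iter m P f x)
    + 1.
  rewrite -[X in _ = _ + X]f1 -(bRintZ pi1); [|by bmeas].
  rewrite -(bRintB pi1); [|by bmeas..].
  rewrite -(bRintD pi1); [|by bmeas..].
  apply: eq_Rintegral => x _; have -> : f x ^+ 2 = sigma ^+ 2 * f x ^+ 2.
    by rewrite s2 mul1r.
  ring.
by move=> h; rewrite -subr_ge0 (_ : _ - _
  = 1 - \int[pi]_x (iter m P f x ^+ 2)) ?subr_ge0//; ring.
Qed.

Lemma spectral_gap_iso_inf m : (0 < m)%N ->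
  L2_spectral_gap p pi -> (0 < iso_inf p pi m)%E.
Proof.
move=> m0 gap.
have [q [c [q0 /andP[c0 c1] hc]]] := spectral_gap_contraction ppi nontriv gap
  m0.
(* With this [eta], [(1 + eta) * c <= 1 - eta], so the defect term must supply at least [eta]. *)
pose eta := (1 - c) / 2.
have eta0 : 0 < eta by rewrite divr_gt0// subr_gt0.
pose L := (1 + eta^-1) * (4 ^+ q * 2).
have L0 : 0 < L by rewrite mulr_gt0 ?addr_gt0 ?invr_gt0// mulr_gt0// exprn_gt0.
apply/iso_inf_gt0P; exists (eta / L); first by rewrite divr_gt0.
move=> A ntA; have [f [bf f0 f1 fm]] := normalized_indicator_iter ntA.
have sf := bmeas_sqint pi1 bf.
have := iter_defect m (expr1n R 2) bf f1; rewrite fm.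
set D := \int[pi]_x _ => hD.
have D0 : 0 <= D by apply: Rintegral_ge0 => x _; exact: sqr_ge0.
(* One more application of [P^m] adds a defect [D]; Young with [eta = 1] doubles both terms, whence
   the crude factor [4] per step. *)
have hj j : \int[pi]_x ((iter (m * j) P f x - f x) ^+ 2) <= 4 ^+ j * D.
  elim: j => [|j ih].
    rewrite muln0 expr0 mul1r (_ : \int[pi]_x _ = 0)//.
    rewrite (_ : 0 = \int[pi]_x 0); last by rewrite (bRint_cst pi1).
    by apply: eq_Rintegral => x _; rewrite subrr expr0n.
  have sj := sqint_iter ppi (m * j) sf; have sm := sqint_iter ppi m sf.
  have := Rint_sqr_young (ltr01) (sqintB (sqint_iter ppi m sj) sm) (sqintB sm
    sf).
  have -> : \int[pi]_x ((iter m P (iter (m * j) P f) x - iter m P f x +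
      (iter m P f x - f x)) ^+ 2)
        = \int[pi]_x ((iter (m * j.+1) P f x - f x) ^+ 2).
    by apply: eq_Rintegral => x _; rewrite mulnS iterD addrA subrK.
  have -> : \int[pi]_x ((iter m P f x - f x) ^+ 2) = D.
    by apply: eq_Rintegral => x _; rewrite mul1r.
  move=> /le_trans; apply; rewrite invr1 exprS.
  apply: (@le_trans _ _ ((1 + 1) * (4 ^+ j * D) + (1 + 1) * D)).
    rewrite lerD2r; apply: ler_wpM2l => //.
    exact: le_trans (le_Rint_iterB ppi m sj sf) ih.
  have : D <= 4 ^+ j * D by rewrite ler_peMl// exprn_ege1// ler1n.
  by rewrite -mulrA; move: (4 ^+ j * D) => u; clear; lra.
have sN := sqint_iter ppi (m * q) sf.
have := Rint_sqr_young eta0 sN (sqintB sf sN).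
have -> : \int[pi]_x ((iter (m * q) P f x + (f x - iter (m * q) P f x)) ^+ 2)
  = 1.
  by rewrite -f1; apply: eq_Rintegral => x _; rewrite subrKC.
have -> : \int[pi]_x ((f x - iter (m * q) P f x) ^+ 2) =
    \int[pi]_x ((iter (m * q) P f x - f x) ^+ 2).
  by apply: eq_Rintegral => x _; rewrite -sqrrN opprB.
move=> h1.
have h2 : \int[pi]_x (iter (m * q) P f x ^+ 2) <= c.
  by have := hc f sf f0; rewrite f1 mulr1.
have h3 : \int[pi]_x ((iter (m * q) P f x - f x) ^+ 2)
  <= 4 ^+ q * (2 * iso_ratio m A).
  apply: (le_trans (hj q)); apply: ler_wpM2l; first exact: exprn_ge0.
  apply: (le_trans hD); rewrite le_eqVlt; apply/orP; left; apply/eqP; ring.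
rewrite ler_pdivrMr//.
have h4 : 1 <= (1 + eta) * c + (1 + eta^-1) * (4 ^+ q * (2 * iso_ratio m A)).
  apply: (le_trans h1); apply: lerD; apply: ler_wpM2l => //.
    by rewrite addr_ge0// ltW.
  by rewrite addr_ge0// invr_ge0 ltW.
have h5 : (1 + eta) * c <= 1 - eta.
  rewrite -subr_ge0 (_ : _ - _ = (1 - c) * (1 - c) / 2); last by rewrite /eta;
    field.
  by rewrite divr_ge0// mulr_ge0// subr_ge0 ltW.
have -> : iso_ratio m A * L = (1 + eta^-1) * (4 ^+ q * (2 * iso_ratio m A)).
  by rewrite /L; ring.
rewrite -lerBlDl in h4; apply: le_trans h4.
by rewrite lerBrDr -lerBrDl.
Qed.

(* [sigma = 1] bounds [k_n(A)] from below and [sigma = -1] bounds [2 - k_n(A)]. *)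
Lemma iso_two_step_bound (s sigma : R) A : 0 < s -> sigma ^+ 2 = 1 ->
  nontrivial_set pi A -> s <= iso_ratio (2 * n) A ->
  s ^+ 2 / 8 <= 1 - sigma * (1 - iso_ratio n A).
Proof.
move=> s0 sg2 ntA sA; have [f [bf f0 f1 fm]] := normalized_indicator_iter ntA.
have sf := bmeas_sqint pi1 bf.
have sg0 : sigma != 0.
  by apply/eqP => sg0; move: sg2; rewrite sg0 expr0n/= => /eqP;
    rewrite eq_sym oner_eq0.
have := iter_defect n sg2 bf f1; rewrite fm.
set E := \int[pi]_x _ => hE.
pose u := iter n P f; pose w := iter (2 * n) P f.
have bu : bmeas u by exact: bmeas_iter_markov.
have bw : bmeas w by exact: bmeas_iter_markov.
have su := bmeas_sqint pi1 bu.
have ssf : sqint pi (fun x => sigma * f x) by exact: sqintZ.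
have ssu : sqint pi (fun x => sigma * u x) by exact: sqintZ.
have sw := bmeas_sqint pi1 bw.
have h1 : \int[pi]_x ((w x - sigma * u x) ^+ 2) <= E.
  have := le_Rint_iterB ppi n su ssf.
  rewrite iter_markovZ//; last exact: sf.1.
  by rewrite /w mul2n -addnn iterD.
(* As [sigma^2 = 1], [w - f] splits into [w - sigma u] and [sigma (u - sigma f)], each of squared
   norm at most [E]. *)
have h2 : \int[pi]_x ((w x - f x) ^+ 2) <= 4 * E.
  have sd : sqint pi (fun x => sigma * (u x - sigma * f x)).
    by apply: sqintZ; exact: sqintB.
  have := Rint_sqr_young ltr01 (sqintB sw ssu) sd.
  have -> : \int[pi]_x ((w x - sigma * u x
    + sigma * (u x - sigma * f x)) ^+ 2) =
      \int[pi]_x ((w x - f x) ^+ 2).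
    apply: eq_Rintegral => x _; have -> : w x - f x = w x - sigma ^+ 2 * f x.
      by rewrite sg2 mul1r.
    by ring.
  have -> : \int[pi]_x ((sigma * (u x - sigma * f x)) ^+ 2) = E.
    by apply: eq_Rintegral => x _; rewrite exprMn sg2 mul1r.
  move=> /le_trans; apply; rewrite invr1.
  move: h1; move: (Rintegral _ _ _) => I; clear; lra.
(* The ratio is the inner product of [f] and [f - w]; weighting Young by [s] leaves [s / 2], half of
   the lower bound [sA]. *)
have h3 : iso_ratio (2 * n) A <= s / 2 + s^-1 / 2 * (4 * E).
  have -> : iso_ratio (2 * n) A = \int[pi]_x (f x * (f x - w x)).
    have -> : iso_ratio (2 * n) A = 1 - (1 - iso_ratio (2 * n) A) by ring.
    rewrite -fm -f1 -(bRintB pi1); [|by bmeas..].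
    by apply: eq_Rintegral => x _; rewrite mulrBr expr2.
  apply: (@le_trans _ _ (\int[pi]_x (s / 2 * f x ^+ 2 + s^-1
    / 2 * (w x - f x) ^+ 2))).
    apply: (le_bRint pi1); [by bmeas|by bmeas|] => x.
    rewrite -subr_ge0 (_ : _ - _ = s^-1 / 2 * (s * f x - (f x - w x)) ^+ 2).
      by rewrite mulr_ge0 ?sqr_ge0// divr_ge0// invr_ge0 ltW.
    by field; rewrite gt_eqF.
  rewrite (bRintD pi1); [|by bmeas..].
  do 2 (rewrite (bRintZ pi1); [|by bmeas]).
  by rewrite f1 mulr1 lerD2l; apply: ler_wpM2l => //;
    rewrite divr_ge0// invr_ge0 ltW.
have h4 := le_trans sA h3.
have h5 : s ^+ 2 <= 4 * E.
  have -> : 4 * E = s * (2 * (s^-1 / 2 * (4 * E))) by field; rewrite gt_eqF.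
  by rewrite expr2 ler_pM2l//; move: h4; move: (s^-1 / 2 * (4 * E)) => x; lra.
rewrite ler_pdivrMr//; apply: (le_trans h5).
apply: (@le_trans _ _ (4 * (2 - 2 * sigma * (1 - iso_ratio n A)))).
  by rewrite ler_pM2l.
by rewrite le_eqVlt; apply/orP; left; apply/eqP; ring.
Qed.

Lemma iso_double_iso : (0 < iso_inf p pi (2 * n))%E ->
  (0 < iso_inf p pi n)%E /\ (iso_sup p pi n < 2%:E)%E.
Proof.
move=> /iso_inf_gt0P[s s0 hs]; split.
  apply/iso_inf_gt0P; exists (s ^+ 2 / 8);
    first by rewrite divr_gt0// exprn_gt0.
  move=> A ntA; have := iso_two_step_bound s0 (expr1n R 2) ntA (hs A ntA).
  by rewrite mul1r opprB addrC subrK.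
apply/iso_sup_lt2P; exists (2 - s ^+ 2 / 8).
  by rewrite ltrBlDr ltrDl divr_gt0// exprn_gt0.
move=> A ntA; have sgn : (-1) ^+ 2 = 1 :> R by rewrite sqrrN expr1n.
have := iso_two_step_bound s0 sgn ntA (hs A ntA).
by rewrite mulN1r opprK; move: (iso_ratio n A) (s ^+ 2 / 8) => x y; lra.
Qed.

Variable C : R.
Hypothesis C0 : 0 < C.
Hypothesis domC : edge_dominated pi (kiter p n) C.

Lemma iso_iso_double : (0 < iso_inf p pi n)%E -> (iso_sup p pi n < 2%:E)%E ->
  (0 < iso_inf p pi (2 * n))%E.
Proof.
move=> /iso_inf_gt0P[kap kap0 hk] /iso_sup_lt2P[K K2 hK].
apply/iso_inf_gt0P.
exists ((2 - K) / (4 * (2 * C + (4 * C + 2) / kap))).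
  apply: divr_gt0; rewrite ?subr_gt0//; apply: mulr_gt0 => //.
  apply: addr_gt0; first exact: mulr_gt0.
  by rewrite divr_gt0// addr_gt0// mulr_gt0.
move=> A ntA; have [mA _] := ntA.
rewrite /iso_ratio /flow markov_kiter_double; last first.
  by apply: bmeas_indic; exact: measurableC.
apply: two_step_isoperimetry => //; first exact: invariant_kiter.
by move=> B ntB; rewrite -/(iso_ratio n B) hk// hK.
Qed.

Lemma iso_double_spectral_gap : (0 < iso_inf p pi (2 * n))%E ->
  L2_spectral_gap p pi.
Proof.
move=> /iso_inf_gt0P[h h0 hA].
pose theta := Num.min h 1 / 2.
have m0 : 0 < Num.min h 1 by rewrite lt_min h0 ltr01.
have m1 : Num.min h 1 <= 1 by rewrite ge_min lexx orbT.
have mh : Num.min h 1 <= h by rewrite ge_min lexx.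
have th0 : 0 < theta by rewrite divr_gt0.
have th1 : theta <= 1.
  by rewrite ler_pdivrMr// mul1r; apply: le_trans m1 _; rewrite ler1n.
have iso A : measurable A -> fine (pi A) <= 2^-1 ->
    theta * fine (pi A) <= flow pi (kiter p (2 * n)) A (~` A).
  move=> mA a2; have [ntA|ntA] := pselect (nontrivial_set pi A).
    have := hA A ntA; have /andP[a0 a1] := nontrivial_fine ntA.
    rewrite /iso_ratio ler_pdivlMr ?mulr_gt0 ?subr_gt0//.
    by apply: le_trans; apply: half_iso_le => //; rewrite ltW.
  (* A trivial set of mass at most one half is null. *)
  have -> : fine (pi A) = 0.
    apply: contrapT => /eqP a0; apply: ntA; split => //.
    have a0' : 0 < fine (pi A) by rewrite lt_neqAle eq_sym a0 fine_ge0.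
    rewrite -[pi A]fineK ?fin_num_measure// !lte_fin a0'/=.
    by apply: le_lt_trans a2 _; rewrite invf_lt1// ltr1n.
  by rewrite mulr0; apply: flow_ge0; exact: measurableC.
(* Cheeger's constant [theta^2 / 8] loses the factor [C] in [edge_dominated_energy]; the cap at one
   is what [bounded_gap_extend] asks. *)
pose delta := Num.min (theta ^+ 2 / 8 / C) 1.
have d0 : 0 < delta by rewrite lt_min ltr01 andbT !divr_gt0// exprn_gt0.
have d1 : delta <= 1 by rewrite ge_min lexx orbT.
apply: (@contraction_spectral_gap _ _ _ pi p ppi nontriv n (1 - delta / 2))
  => //.
  apply/andP; split.
    by rewrite subr_ge0 ler_pdivrMr// mul1r; apply: le_trans d1 _;
      rewrite ler1n.
  by rewrite ltrBlDr ltrDl divr_gt0.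
apply: bounded_gap_extend => //; first by rewrite d0.
move=> b bb.
have kpi := invariant_kiter n ppi.
have := cheeger (invariant_kiter (2 * n) ppi) _ iso bb.
rewrite th0 th1 => /(_ isT); rewrite markov_kiter_double//.
move=> /le_trans/(_ (edge_dominated_energy kpi domC bb)).
rewrite (markov_kiter p n bb).
have := bRint_sqr_ge pi1 bb.
move: (\int[pi]_x (b x ^+ 2)) (\int[pi]_x (iter n P b x ^+ 2)) ((\int[pi]_x b
  x) ^+ 2).
move=> B G m mB hG.
have : delta * (B - m) <= B - G.
  apply: (@le_trans _ _ (theta ^+ 2 / 8 / C * (B - m))).
    by apply: ler_wpM2r; rewrite ?subr_ge0// ge_min lexx.
  by rewrite mulrAC ler_pdivrMr// [leRHS]mulrC.
have -> : (1 - delta) * B + delta * m = B - delta * (B - m) by ring.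
by rewrite lerBrDr addrC -lerBrDr.
Qed.

End equivalences.

Theorem theorem2 (d : measure_display) (T : measurableType d) (R : realType)
    (p : R.-pker T ~> T) (pi : probability T R) (n : nat)
    (n_gt0 : (0 < n)%N)
    (p_posrec : positive_recurrent p)
    (pi_inv : unique_invariant_probability p pi)
    (pi_nontrivial : exists A, nontrivial_set pi A)
    (Q_equiv : equivalent_edge_measures p pi n)
    (p_wrev : weak_reversible p pi n) :
  (L2_spectral_gap p pi <-> 0 < iso_inf p pi (2 * n)) /\
  (0 < iso_inf p pi (2 * n) <->
   [/\ 0 < iso_inf p pi n, iso_inf p pi n <= iso_sup p pi n
     & iso_sup p pi n < 2%:E]).
Proof.
have [ppi _] := pi_inv.
have [C C0 domC] := weak_reversible_edge_dominated Q_equiv p_wrev.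
have n2_gt0 : (0 < 2 * n)%N by rewrite muln_gt0.
split; split.
- exact: spectral_gap_iso_inf.
- exact: (iso_double_spectral_gap n_gt0 ppi pi_nontrivial C0 domC).
- move=> h.
  have [h1 h2] := iso_double_iso ppi pi_nontrivial h.
  by split => //; exact: iso_inf_le_sup.
- move=> [h1 _ h2]; exact: (iso_iso_double ppi pi_nontrivial C0 domC).
Qed.
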